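(* Let $ABC$ be a nondegenerate triangle in the Euclidean plane with angles $A,B,C$, incenter $I$, inradius $r$, circumradius $R$ and semiperimeter $s$. Let $P,Q$ be independent points uniformly distributed (with respect to area) in the interior of $ABC$, and let $\mathcal D(ABC)$ be the probability that $I$ lies in the closed disk having the segment $PQ$ as a diameter. Then $$\mathcal D(ABC)=\left(\frac rs\right)^2\left[\frac{8R}{r}-1-\Gamma(\cos A)-\Gamma(\cos B)-\Gamma(\cos C)\right].$$
   Context: The function $\Gamma:[-1,1]\to\mathbb R$ (not the Euler Gamma function) is defined by $$\Gamma(t)=\frac1t-\frac{1-t^2}{t^2}\operatorname{artanh}t\qquad(-1<t<1,\ t\neq0),$$ with continuous extensions $\Gamma(0)=0$, $\Gamma(1)=1$, $\Gamma(-1)=-1$. Here $\operatorname{artanh}t=\frac12\log\frac{1+t}{1-t}$. *)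

(* Defs.v *)
From HB Require Import structures.
From mathcomp Require Import all_boot all_order all_algebra.
From mathcomp Require Import all_classical all_reals all_analysis.

Set Implicit Arguments.
Unset Strict Implicit.
Unset Printing Implicit Defensive.

Import Order.TTheory GRing.Theory Num.Theory.
Import numFieldNormedType.Exports.

Local Open Scope classical_set_scope.
Local Open Scope ring_scope.

(* The Euclidean plane is R * R. The library's norm on R * R is the sup norm,
   so the Euclidean distance is defined separately. *)

Definition dot (R : realType) (u v : R * R) : R := u.1 * v.1 + u.2 * v.2.

Definition edist (R : realType) (U V : R * R) : R :=
  Num.sqrt (dot (V - U) (V - U)).

Definition closed_disk (R : realType) (M : R * R) (rad : R) : set (R * R) :=
  [set X | edist M X <= rad].

Definition diametral_disk (R : realType) (U V : R * R) : set (R * R) :=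
  closed_disk (2^-1 *: (U + V)) (edist U V / 2).

Definition line (R : realType) (U V : R * R) : set (R * R) :=
  [set X | exists t : R, X = (1 - t) *: U + t *: V].

Definition collinear (R : realType) (A B C : R * R) : Prop :=
  exists U V, [/\ line U V A, line U V B & line U V C].

Definition triangle (R : realType) (A B C : R * R) : set (R * R) :=
  [set X | exists a b c : R,
     [/\ 0 <= a, 0 <= b, 0 <= c, a + b + c = 1
       & X = a *: A + b *: B + c *: C]].

(* The angle at V between the rays VU and VW, in [0, pi]. *)
Definition angle (R : realType) (U V W : R * R) : R :=
  acos (dot (U - V) (W - V) / (edist V U * edist V W)).

(* Meant for a line l and rad > 0: having exactly one common point is not
   tangency for a general curve l. *)
Definition tangent (R : realType) (M : R * R) (rad : R) (l : set (R * R)) :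
    Prop :=
  exists! X, l X /\ edist M X = rad.

(* The incircle lies in the triangle, which excludes the excircles. *)
Definition is_incircle (R : realType) (A B C I : R * R) (r : R) : Prop :=
  [/\ 0 < r, closed_disk I r `<=` triangle A B C,
      tangent I r (line B C), tangent I r (line C A)
    & tangent I r (line A B)].

Definition is_circumradius (R : realType) (A B C : R * R) (Rc : R) : Prop :=
  exists O, [/\ edist O A = Rc, edist O B = Rc & edist O C = Rc].

Definition semiperimeter (R : realType) (A B C : R * R) : R :=
  (edist B C + edist C A + edist A B) / 2.

Definition artanh (R : realType) (t : R) : R := 2^-1 * ln ((1 + t) / (1 - t)).

(* Only the values on [-1, 1] are meaningful. *)
Definition Gam (R : realType) (t : R) : R :=
  if t == 0 then 0
  else if t == 1 then 1
  else if t == -1 then -1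
  else 1 / t - (1 - t ^+ 2) / t ^+ 2 * artanh t.

Definition area (R : realType) : set (R * R) -> \bar R :=
  (@lebesgue_measure R \x @lebesgue_measure R)%E.

Definition uniform_on (d : measure_display) (T : measurableType d)
    (R : realType) (Pr : probability T R)
    (X : {RV Pr >-> (R * R)%type}) (D : set (R * R)) : Prop :=
  forall E : set (R * R), measurable E ->
    distribution Pr X E = (area (E `&` D) / area D)%E.

Definition independent_RV (d d1 d2 : measure_display) (T : measurableType d)
    (T1 : measurableType d1) (T2 : measurableType d2)
    (R : realType) (Pr : probability T R)
    (X : {RV Pr >-> T1}) (Y : {RV Pr >-> T2}) : Prop :=
  forall (E : set T1) (F : set T2), measurable E -> measurable F ->
    Pr (X @^-1` E `&` Y @^-1` F) = (Pr (X @^-1` E) * Pr (Y @^-1` F))%E.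

(* Main.v *)
(** The incenter I lies in the disk with diameter PQ iff <P - I, Q - I> <= 0, a
    condition that only depends on the directions of P and Q from I.  Cut the
    triangle into the cones over its three sides with apex I.  Parametrizing a
    side by the signed distance from its tangent point, in units of r, the
    integral over a cone of a function that is homogeneous of degree 0 about I is
    r^2/2 times an integral over the side.  The probability thus becomes a sum of
    nine planar areas, one for each pair of sides.  Write a = cot (A/2),
    b = cot (B/2), c = cot (C/2).  For the side AB paired with itself the region
    is 1 + t u <= 0 in [-a, b]^2, of area 2 (ab - 1 - ln (ab)).  For the two sides
    at A, with coordinates x, y increasing towards A, it is
    cos A (xy - 1) + sin A (x + y) <= 0 in [-b, a] x [-c, a], of area
    ab + bc + ca - 1 - 2 Gamma(cos A) + 2 ln a.  The logarithms cancel in the sum,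
    and abc = a + b + c, s = r (a + b + c), 4 R / r = ab + bc + ca - 1. *)

Require Import Defs.
From HB Require Import structures.
From mathcomp Require Import all_boot all_order all_algebra.
From mathcomp Require Import all_classical all_reals all_analysis.
From mathcomp Require Import measurable_realfun.
From mathcomp Require Import ring lra.
Set Implicit Arguments.
Unset Strict Implicit.
Unset Printing Implicit Defensive.
Import Order.TTheory GRing.Theory Num.Theory.
Import numFieldNormedType.Exports.
Local Open Scope classical_set_scope.
Local Open Scope ring_scope.

(** * Linear changes of variables in the plane *)

(** With v = cot (V/2), cos V and sin V are rational in v. Once a frame at I is fixed, the geometric
    identities become rational ones, left to [field] and [ring]; angles return only in
    [cos_angle_A]. Homogeneity is used twice, in Q for fixed P and then in P, so that both points
    end up on the sides. Gamma comes from the pairs of adjacent sides: for fixed x the condition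
    bounds y by a Moebius function of x, whose antiderivative contains a logarithm with coefficient
    1/(cos V)^2. That formula degenerates at a right angle, which is therefore integrated
    separately. The frames assume a positively oriented triangle; exchanging B and C achieves this.
    The logarithms cancel already among the three pairs that have P on a given side. *)

Section lebesgue_affine.
Context (R : realType).
Local Notation mu := (@lebesgue_measure R).
Variables (k c : R).
Hypothesis k0 : k != 0.
Let phi (x : R) : R := k * x + c.

Let mphi : measurable_fun [set: measurableTypeR R] (phi : _ -> measurableTypeR R).
Proof. by apply: measurable_funD => //; apply: measurable_funM. Qed.

Let phi_mfun : {mfun measurableTypeR R >-> measurableTypeR R} :=
  HB.pack (phi : measurableTypeR R -> measurableTypeR R) (isMeasurableFun.Build _ _ _ _ _ mphi).

(** Uniqueness of Lebesgue measure: the scaled push-forward has the right value on half-open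
    intervals. For k < 0 the preimage is half-open at the other end, hence two cases. *)
Lemma lebesgue_measure_affine (A : set R) : measurable A ->
  mu A = (`|k|%:E * mu (phi @^-1` A))%E.
Proof.
move=> mA.
pose k' : {nonneg R} := NngNum (normr_ge0 k).
apply: (@lebesgue_measure_unique R (mscale k' (pushforward mu phi_mfun))); last exact: mA.
move=> _ [[a b]] _ <-.
change (mu `]a, b] = (`|k|%:E * mu (phi @^-1` `]a, b]%classic))%E).
have [kpos|kneg] : 0 < k \/ k < 0 by case: (ltgtP k 0) k0 => //; [right|left].
- have -> : phi @^-1` `]a, b]%classic = `](a - c) / k, (b - c) / k]%classic.
    rewrite predeqE => x; rewrite /preimage/mkset /phi !in_itv/=.
    by rewrite ltr_pdivrMr// ler_pdivlMr// ltrBlDr lerBrDr (mulrC x).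
  rewrite !lebesgue_measure_itv/= !lte_fin ltr_pM2r ?invr_gt0// ltrD2r.
  case: ifP => _; last by rewrite mule0.
  rewrite -!EFinD -EFinM gtr0_norm//; congr (_%:E); field; lra.
- have -> : phi @^-1` `]a, b]%classic = `[(b - c) / k, (a - c) / k[%classic.
    rewrite predeqE => x; rewrite /preimage/mkset /phi !in_itv/=.
    by rewrite ltr_ndivlMr// ler_ndivrMr// ltrBlDr lerBrDr (mulrC x) andbC.
  rewrite !lebesgue_measure_itv/= !lte_fin ltr_nM2r ?invr_lt0// ltrD2r.
  case: ifP => _; last by rewrite mule0.
  rewrite -!EFinD -EFinM ltr0_norm//; congr (_%:E); field; lra.
Qed.

Lemma ge0_integral_affine (f : R -> \bar R) :
  measurable_fun setT f -> (forall x, (0 <= f x)%E) ->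
  (\int[mu]_x f x = `|k|%:E * \int[mu]_x f (k * x + c)%R)%E.
Proof.
move=> mf f0.
pose k' : {nonneg R} := NngNum (normr_ge0 k).
rewrite (@eq_measure_integral _ _ _ setT (mscale k' (pushforward mu phi_mfun))); last first.
  by move=> A mA _; rewrite /mscale/= /pushforward/=; exact: lebesgue_measure_affine.
rewrite ge0_integral_mscale//; congr (_ * _)%E.
by rewrite ge0_integral_pushforward.
Qed.
End lebesgue_affine.

Section plane.
Context (R : realType).
Local Notation mu := (@lebesgue_measure R).
Local Notation plane := (measurableTypeR R * measurableTypeR R)%type.
Local Notation parea := (mu \x mu : set plane -> \bar R)%E.

(** Change of variables for nonnegative integrands, with k as the absolute Jacobian. Measurability
    is bundled so that such maps compose. *)
Definition rescales_area (k : R) (phi : R * R -> R * R) :=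
  measurable_fun [set: plane] (phi : plane -> plane) /\
  forall f : plane -> \bar R, measurable_fun [set: plane] f ->
    (forall p, 0 <= f p)%E ->
    (\int[parea]_p f p = k%:E * \int[parea]_p f (phi p))%E.

Lemma rescales_area_comp k l (phi psi : R * R -> R * R) :
  rescales_area k phi -> rescales_area l psi ->
  rescales_area (k * l) (phi \o psi).
Proof.
move=> [mphi hphi] [mpsi hpsi]; split; first exact: (measurableT_comp mphi mpsi).
move=> f mf f0; rewrite hphi// EFinM -muleA; congr (_ * _)%E.
apply: (hpsi (f \o phi)) => [|p]; last exact: f0.
exact: (measurableT_comp mf mphi).
Qed.

Lemma rescales_area_swap : rescales_area 1 (fun p => (p.2, p.1)).
Proof.
have msw : measurable_fun [set: plane] (fun p : plane => (p.2, p.1) : plane).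
  by apply: measurable_fun_pair; [exact: measurable_snd|exact: measurable_fst].
split=> // f mf f0; rewrite mul1e (fubini_tonelli2 f)//.
by rewrite (fubini_tonelli1 (fun p : plane => f (p.2, p.1)))//; exact: (measurableT_comp mf).
Qed.

(** On each vertical line this is a one-dimensional affine map of slope k; Tonelli integrates the
    one-dimensional formula. *)
Lemma rescales_area_fiber (k c e : R) : k != 0 ->
  rescales_area `|k| (fun p => (p.1, k * p.2 + (c * p.1 + e))).
Proof.
move=> k0.
have msw : measurable_fun [set: plane]
    (fun p : plane => (p.1, k * p.2 + (c * p.1 + e)) : plane).
  apply: measurable_fun_pair; first exact: measurable_fst.
  apply: measurable_funD; first by apply: measurable_funM => //; exact: measurable_snd.
  apply: measurable_funD => //; apply: measurable_funM => //; exact: measurable_fst.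
split=> // f mf f0; rewrite (fubini_tonelli1 f)//.
pose g (p : plane) := f (p.1, k * p.2 + (c * p.1 + e)).
have mg : measurable_fun setT g by exact: (measurableT_comp mf msw).
have g0 p : (0 <= g p)%E by exact: f0.
rewrite (fubini_tonelli1 g)//.
rewrite -ge0_integralZl//=; last 2 first.
- exact: measurable_fun_fubini_tonelli_F.
- by move=> x _; exact: integral_ge0.
apply: eq_integral => x _.
rewrite /fubini_F (@ge0_integral_affine _ k (c * x + e) k0 (fun y => f (x, y)))//.
exact: (measurable_fun_pair2 x mf).
Qed.

(** If [w.1] is nonzero, the map is a fibre map, then the swap, then another fibre map. If [w.1]
    vanishes, [u.1] does not, and u and w exchange roles. *)
Lemma rescales_area_linear (O u w : R * R) : u.1 * w.2 - u.2 * w.1 != 0 ->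
  rescales_area `|u.1 * w.2 - u.2 * w.1|
    (fun p => O + p.1 *: u + p.2 *: w).
Proof.
move: u w.
have H (u w : R * R) : w.1 != 0 -> u.1 * w.2 - u.2 * w.1 != 0 ->
    rescales_area `|u.1 * w.2 - u.2 * w.1| (fun p => O + p.1 *: u + p.2 *: w).
  move=> w1 D0.
  pose D := u.1 * w.2 - u.2 * w.1.
  (* Once the first coordinate X of the image replaces y as a variable, the second coordinate is
     affine in x, with slope -D / w.1. *)
  have l0 : - (D / w.1) != 0 by rewrite oppr_eq0 mulf_neq0// invr_eq0.
  have := rescales_area_comp (rescales_area_comp
    (rescales_area_fiber (w.2 / w.1) (O.2 - w.2 / w.1 * O.1) l0) rescales_area_swap)
    (rescales_area_fiber u.1 O.1 w1).
  rewrite mulr1 normrN normrM normfV divfK ?normr_eq0//.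
  congr rescales_area; apply/funext => -[x y] /=; rewrite /D.
  case: O u w D D0 l0 w1 => O1 O2 [u1 u2] [w1 w2]/= _ _ _ w1N0.
  congr (_, _).
    by transitivity (O1 + x * u1 + y * w1); first ring.
  by transitivity (O2 + x * u2 + y * w2); first field.
move=> u w D0; have [w1|] := eqVneq w.1 0; last by move=> /H; exact.
have u1 : u.1 != 0 by apply: contraNneq D0 => ->; rewrite w1; apply/eqP; ring.
have D1 : w.1 * u.2 - w.2 * u.1 != 0 by apply: contraNneq D0 => E; apply/eqP; lra.
have := rescales_area_comp (H w u u1 D1) rescales_area_swap.
rewrite mulr1 -normrN.
rewrite (_ : - (w.1 * u.2 - w.2 * u.1) = u.1 * w.2 - u.2 * w.1); last by ring.
by congr rescales_area; apply/funext => p /=; rewrite addrAC.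
Qed.

End plane.


(** * The fundamental theorem of calculus on a closed interval *)

Section ftc.
Context (R : realType).
Local Notation mu := (@lebesgue_measure R).

Lemma integral_is_derive (f F : R -> R) (a b : R) : a <= b ->
  (forall x, a <= x <= b -> is_derive x 1 F (f x)) ->
  (forall x, a <= x <= b -> {for x, continuous f}) ->
  (\int[mu]_(x in `[a, b]) (f x)%:E = (F b - F a)%:E)%E.
Proof.
rewrite le_eqVlt => /predU1P[<- _ _|ab dF cf].
  by rewrite set_itv1 integral_set1 subrr.
have cF x : a <= x <= b -> {for x, continuous F}.
  by move=> /dF [dFx _]; exact/differentiable_continuous/derivable1_diffP.
rewrite (@continuous_FTC2 _ f F a b ab).
- by rewrite EFinB.
- apply: continuous_in_subspaceT => x /=; rewrite inE/= in_itv/=; exact: cf.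
- split.
  + by move=> x; rewrite in_itv/= => /andP[ax xb]; have [] := dF x; rewrite ?(ltW ax) ?ltW.
  + by apply: cvg_at_right_filter; apply: cF; rewrite lexx ltW.
  + by apply: cvg_at_left_filter; apply: cF; rewrite lexx ltW.
- move=> x; rewrite in_itv/= => /andP[ax xb]; have xab : a <= x <= b by rewrite !ltW.
  by case: (dF x xab) => _ <-; rewrite derive1E.
Qed.

End ftc.

(** * Cone integrals of functions homogeneous of degree 0 *)

Section cone.
Context (R : realType).
Local Notation mu := (@lebesgue_measure R).
Local Notation plane := (measurableTypeR R * measurableTypeR R)%type.
Local Notation parea := (mu \x mu : set plane -> \bar R)%E.

Definition rot (u : R * R) : R * R := (- u.2, u.1).

(* Polar coordinates along the segment from F + (-a) rot F to F + b rot F. *)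
Lemma cone_integral (O F : R * R) (a b : R) (f : plane -> \bar R) (K : set plane) :
  F != 0 -> measurable K ->
  (forall x w : R, K (O + x *: F + w *: rot F) <-> 0 < x < 1 /\ - a * x <= w < b * x) ->
  measurable_fun setT f -> (forall p, (0 <= f p)%E) ->
  (forall (x : R) (v : R * R), 0 < x -> f (O + x *: v) = f (O + v)) ->
  (\int[parea]_(p in K) f p =
    (dot F F / 2)%:E * \int[mu]_(t in `[(- a)%R, b[) f (O + F + t *: rot F)%R)%E.
Proof.
move=> F0 mK KE mf f0 fh.
have dF : 0 < F.1 * F.1 + F.2 * F.2.
  rewrite -!expr2 lt_neqAle addr_ge0 ?sqr_ge0// andbT eq_sym.
  apply: contra F0; rewrite paddr_eq0 ?sqr_ge0// !sqrf_eq0 => /andP[/eqP h1 /eqP h2].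
  by apply/eqP; case: F h1 h2 {mK KE} => ? ? /= -> ->.
have := @rescales_area_linear R O F (rot F).
rewrite /rot/= mulrN opprK gt_eqF// gtr0_norm// => /(_ isT) [mphi hphi].
rewrite integral_mkcond.
have mfK : measurable_fun setT (f \_ K).
  by apply/(measurable_restrictT _ mK); exact: measurable_funTS.
have fK0 p : (0 <= (f \_ K) p)%E by rewrite patchE; case: ifP.
rewrite hphi//.
pose g : plane -> \bar R := fun p => (f \_ K) ((O : R * R) + (p.1 : R) *: F + (p.2 : R) *: rot F).
have mg : measurable_fun setT g := measurableT_comp mfK mphi.
have g0 p : (0 <= g p)%E by exact: fK0.
rewrite [X in (_ * X)%E](_ : _ = \int[mu]_x fubini_F mu g x)%E; last first.
  exact: (fubini_tonelli1 g mg g0).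
pose G (t : R) := f (O + F + t *: rot F).
pose C := (\int[mu]_(t in `[(- a)%R, b[) G t)%E.
rewrite (_ : \int[mu]_x fubini_F mu g x = \int[mu]_(x in `]0%R, 1%R[) (x%:E * C))%E; last first.
  rewrite [RHS]integral_mkcond; apply: eq_integral => x _.
  rewrite patchE /fubini_F; case: ifPn; rewrite mem_setE in_itv/=.
    move=> /andP[x0 x1].
    (* Substituting w = x t costs a factor x; by homogeneity the remaining integral is C, whatever x
       is. *)
    rewrite (@ge0_integral_affine _ x 0 _ (fun y => g (x, y))) ?gt_eqF//; last first.
      exact: (measurable_fun_pair2 x mg).
    rewrite gtr0_norm//; congr (_ * _)%E.
    rewrite /C [RHS]integral_mkcond; apply: eq_integral => t _.
    rewrite /g /G !patchE/= addr0.
    have -> : O + x *: F + (x * t) *: rot F = O + x *: (F + t *: rot F).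
      by rewrite scalerDr scalerA addrA.
    have [tab|tab] := boolP (t \in `[(- a), b[%classic); rewrite mem_setE in_itv/= in tab.
      rewrite mem_set ?fh ?addrA// scalerDr scalerA addrA; apply/KE; split; first by rewrite x0.
      by rewrite mulrC ler_pM2l// (mulrC b) ltr_pM2l.
    rewrite memNset// scalerDr scalerA addrA => /KE[_].
    by rewrite mulrC ler_pM2l// (mulrC b) ltr_pM2l//; apply/negP.
  move=> x01; apply: integral0_eq => w _; rewrite /g patchE memNset//=.
  by move=> /KE[]; rewrite (negbTE x01).
have mE D : measurable_fun D (fun x : measurableTypeR R => (x : R)%:E).
  by apply: measurable_funTS; apply/measurable_EFinP; exact: measurable_id.
rewrite ge0_integralZr//=; last 2 first.
- by move=> x; rewrite in_itv/= => /andP[/ltW]; rewrite lee_fin.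
- by apply: integral_ge0 => t _; exact: f0.
rewrite integral_itv_bndo_bndc;last exact: mE.
rewrite integral_itv_obnd_cbnd;last exact: mE.
(* This is the 1/2 of the final constant; the factor [dot F F] is the Jacobian of the frame. *)
have -> : (\int[mu]_(x in `[0%R, 1%R]) (x : R)%:E = (2^-1)%:E)%E.
  have dF2 (x : R) : is_derive x 1 (fun x : R => x ^+ 2 / 2) x.
    by apply: is_derive_eq; rewrite /GRing.scale/=; field.
  have := @integral_is_derive R id (fun x => x ^+ 2 / 2) 0 1 ler01.
  rewrite expr1n expr0n/= mul0r subr0 div1r.
  by apply => x _; exact: cvg_id.
by rewrite muleA -EFinM /dot.
Qed.

End cone.

(** * One-dimensional integrals *)

Section interval_integrals.
Context (R : realType).
Local Notation mu := (@lebesgue_measure R).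

(* Half-open intervals concatenate without case distinction on degenerate ones. *)
Definition has_integral (h : R -> \bar R) (l r v : R) :=
  [/\ l <= r, measurable_fun (`]l, r]%classic : set (measurableTypeR R)) h &
      (\int[mu]_(x in `]l, r]) h x = v%:E)%E].

Lemma has_integral_bnd h l r v b0 b1 : has_integral h l r v ->
  (\int[mu]_(x in [set` Interval (BSide b0 l) (BSide b1 r)]) h x = v%:E)%E.
Proof.
move=> [_ mh <-].
have mh' : measurable_fun (`]l, r[%classic : set (measurableTypeR R)) h.
  exact/emeasurable_fun_itv_bndo_bndcP.
by rewrite (@integral_itv_bndoo R l r h b0 b1 mh') integral_itv_bndo_bndc.
Qed.

Lemma has_integral_cat h l m r v w : (forall x, 0 <= h x)%E ->
  has_integral h l m v -> has_integral h m r w -> has_integral h l r (v + w).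
Proof.
move=> h0 [lm ml vE] [mr m_r wE].
have lr := le_trans lm mr.
have E : `]l, r]%classic = `]l, m] `|` `]m, r] :> set R.
  by rewrite -itv_bndbnd_setU// bnd_simp.
have mh : measurable_fun (`]l, m] `|` `]m, r] : set (measurableTypeR R)) h.
  exact/measurable_funU.
split; rewrite ?E// ge0_integral_setU//; first by rewrite vE wE.
apply/disj_setPRL => x /=; rewrite !in_itv/= => /andP[mx _] /andP[_ xm].
by move: mx; rewrite ltNge xm.
Qed.

Lemma has_integral_add h1 h2 l r v w :
  (forall x, 0 <= h1 x)%E -> (forall x, 0 <= h2 x)%E ->
  has_integral h1 l r v -> has_integral h2 l r w ->
  has_integral (fun x => h1 x + h2 x)%E l r (v + w).
Proof.
move=> h10 h20 [lr m1 v1] [_ m2 v2]; split => //; first exact: emeasurable_funD.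
by rewrite ge0_integralD// v1 v2.
Qed.

(** The formula for h is only required inside the interval, as section lengths change their formula
    at the cut points. Measurability of h follows from continuity of f. *)
Lemma has_integral_ftc (h : R -> \bar R) (f F : R -> R) (l r v : R) : l <= r ->
  (forall x, l < x < r -> h x = (f x)%:E) ->
  (forall x, l <= x <= r -> is_derive x 1 F (f x)) ->
  (forall x, l <= x <= r -> {for x, continuous f}) ->
  v = F r - F l -> has_integral h l r v.
Proof.
move=> lr hf dF cf ->.
have mf : measurable_fun (`]l, r[%classic : set (measurableTypeR R)) (fun x => (f x)%:E).
  apply/measurable_EFinP; apply: open_continuous_measurable_fun; first exact: interval_open.
  by move=> x; rewrite inE/= in_itv/= => /andP[lx xr]; apply: cf; rewrite !ltW.
have mh : measurable_fun (`]l, r[%classic : set (measurableTypeR R)) h.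
  apply: eq_measurable_fun mf => x; rewrite inE/= in_itv/= => xlr.
  by rewrite hf.
split=> //; first exact/emeasurable_fun_itv_bndo_bndcP.
have := @integral_is_derive R f F l r lr dF cf => <-.
rewrite integral_itv_bndoo// [RHS]integral_itv_bndoo//.
by apply: eq_integral => x; rewrite inE/= in_itv/= => /hf.
Qed.

End interval_integrals.

(** * Two points on the same side *)

Section one_dimensional.
Context (R : realType).
Local Notation mu := (@lebesgue_measure R).
Implicit Types (a b p v s t u : R).

Lemma lebesgue_measure_bnd (l r : R) (b0 b1 : bool) : l <= r ->
  mu [set` Interval (BSide b0 l) (BSide b1 r)] = (r - l)%:E.
Proof.
rewrite le_eqVlt lebesgue_measure_itv/= lte_fin => /predU1P[->|->].
  by rewrite ltxx subrr.
by rewrite EFinB.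
Qed.

Lemma is_derive_affine_ln (k c x : R) : 0 < k * x + c ->
  is_derive x 1 (fun x => ln (k * x + c)) (k / (k * x + c)).
Proof.
move=> h; have dl : is_derive (k * x + c) 1 (@ln R) (k * x + c)^-1 by exact: is_derive1_ln.
have da : is_derive x 1 (fun x : R => k * x + c) k.
  by apply: is_derive_eq; rewrite /GRing.scale/=; ring.
by have := @is_derive1_comp R (@ln R) (fun x => k * x + c) x _ _ dl da; rewrite mulrC.
Qed.

(* [<F + t J F, F + u J F> <= 0] for a unit vector [F]. *)
Definition same_side (t u : R) := 1 + t * u <= 0.

Lemma same_side_has_integral a b : 0 < a -> 0 < b -> 1 <= a * b ->
  has_integral (fun t => mu [set u : R | - a <= u < b /\ same_side t u]) (- a) b
    (2 * (a * b - 1 - ln (a * b))).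
Proof.
move=> a0 b0 ab.
have b1 : b^-1 <= a by rewrite -[leLHS]mul1r ler_pdivrMr.
have a1 : a^-1 <= b by rewrite -[leLHS]mul1r ler_pdivrMr// mulrC.
have ai : 0 < a^-1 by rewrite invr_gt0.
have bi : 0 < b^-1 by rewrite invr_gt0.
have lnab : ln (a * b) = ln a + ln b by rewrite lnM.
have cont_inv (t : R) : t != 0 -> {for t, continuous (fun t : R => t^-1)}.
  by move=> t0; exact: inv_continuous.
have cut (t u : R) : t != 0 -> 1 + t * u = t * (u - (- t^-1)).
  by move=> t0; field.
(* The section is empty for t between -1/b and 1/a; it is an interval of length b + 1/t to the left
   and of length a - 1/t to the right. The two outer pieces contribute equally. *)
rewrite (_ : 2 * _ = (a * b - 1 - ln (a * b)) + 0 + (a * b - 1 - ln (a * b))); last by ring.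
apply: (@has_integral_cat _ _ _ a^-1) => //; first apply: (@has_integral_cat _ _ _ (- b^-1)) => //.
- apply: (@has_integral_ftc _ _ (fun t => b + t^-1) (fun t => b * t + ln (-1 * t + 0))).
  + by rewrite lerN2.
  + move=> t /andP[ta tb].
    have t0 : t < 0 by apply: lt_trans tb _; rewrite oppr_lt0.
    have tN0 : t != 0 by rewrite lt_eqF.
    have t1 : 0 < - t^-1 by rewrite oppr_gt0 invr_lt0.
    have t2 : - t^-1 <= b.
      rewrite -invrN -[leRHS]invrK lef_pV2 ?posrE ?oppr_gt0//.
      by rewrite lerNr ltW.
    rewrite (_ : [set u | _] = `[- t^-1, b[%classic).
      by rewrite lebesgue_measure_bnd ?opprK.
    rewrite predeqE => u /=; rewrite in_itv/= /same_side (cut _ _ tN0) nmulr_rle0// subr_ge0.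
    by split=> [[/andP[_ ->] ->]//|/andP[h ->]]; split=> //; rewrite andbT; lra.
  + move=> t /andP[_ tb].
    have t0 : 0 < -1 * t + 0 by lra.
    have dl := is_derive_affine_ln t0.
    apply: is_derive_eq; rewrite /GRing.scale/=; field; lra.
  + move=> t /andP[_ tb]; apply: cvgD; first exact: cvg_cst.
    by apply: cont_inv; lra.
  + have -> : -1 * - b^-1 + 0 = b^-1 by ring.
    have -> : -1 * - a + 0 = a by ring.
    rewrite lnab lnV ?posrE//; field; lra.
- apply: (@has_integral_ftc _ _ (fun=> 0) (fun=> 0)).
  + by lra.
  + move=> t /andP[ta tb] /=.
    rewrite (_ : [set u | _] = set0) ?measure0//.
    rewrite predeqE => u /=; split=> // -[/andP[u1 u2]]; rewrite /same_side.
    have h1 : t * a < 1 by rewrite -ltr_pdivlMr// div1r.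
    have h2 : - 1 < t * b by rewrite -ltr_pdivrMr// mulN1r.
    have [t0|t0] := leP 0 t; first by nra.
    by nra.
  + by move=> t _; exact: cst_continuous.
  + by rewrite subrr.
- apply: (@has_integral_ftc _ _ (fun t => a - t^-1) (fun t => a * t - ln (1 * t + 0))).
  + by [].
  + move=> t /andP[ta tb].
    have t0 : 0 < t by apply: lt_trans ta.
    have tN0 : t != 0 by rewrite gt_eqF.
    have t1 : 0 < t^-1 by rewrite invr_gt0.
    have t2 : t^-1 <= a by rewrite -[leRHS]invrK lef_pV2 ?posrE ?invr_gt0// ltW.
    rewrite (_ : [set u | _] = `[- a, - t^-1]%classic).
      by rewrite lebesgue_measure_bnd ?lerN2// addrC opprK.
    rewrite predeqE => u /=; rewrite in_itv/= /same_side (cut _ _ tN0) pmulr_rle0// subr_le0.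
    by split=> [[/andP[-> _] ->]//|/andP[-> h]]; split=> //=; lra.
  + move=> t /andP[ta _].
    have t0 : 0 < 1 * t + 0 by lra.
    have dl := is_derive_affine_ln t0.
    apply: is_derive_eq; rewrite /GRing.scale/=; field; lra.
  + move=> t /andP[ta _]; apply: cvgB; first exact: cvg_cst.
    by apply: cont_inv; lra.
  + have -> : 1 * b + 0 = b by ring.
    have -> : 1 * a^-1 + 0 = a^-1 by ring.
    rewrite lnab lnV ?posrE//; field; lra.
Qed.

End one_dimensional.

(** * Sigma-finiteness of plane area *)

Section area_sigma_finite.
Context (R : realType).
Local Notation mu := (@lebesgue_measure R).
Local Notation plane := (measurableTypeR R * measurableTypeR R)%type.
Local Notation parea := (mu \x mu : set plane -> \bar R)%E.

Lemma sigma_finite_area : sigma_finite [set: plane] parea.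
Proof.
pose J (n : nat) : set (measurableTypeR R) := `](- n%:R : R), n%:R]%classic.
exists (fun n => J n `*` J n).
  rewrite predeqE => -[x y]; split=> // _.
  have [n _ xn] : (\bigcup_n J n) x by rewrite /J bigcup_itvT.
  have [k _ yk] : (\bigcup_n J n) y by rewrite /J bigcup_itvT.
  have sub (i j : nat) : (i <= j)%N -> J i `<=` J j.
    move=> ij z; rewrite /J /= !in_itv/= => /andP[z1 z2].
    have := ij; rewrite -(ler_nat R) => h; apply/andP; split.
      by apply: le_lt_trans z1; rewrite lerN2.
    exact: le_trans z2 h.
  by exists (maxn n k) => //; split=> /=; [exact: (sub n _ (leq_maxl _ _) x)|exact: (sub k _ (leq_maxr _ _) y)].
move=> n; have mJ : measurable (J n) by exact: measurable_itv.
split; first exact: measurableX.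
rewrite product_measure1E//.
have nn : - (n%:R : R) <= n%:R by rewrite -subr_ge0 opprK addr_ge0.
have JE : mu (J n) = (n%:R - - (n%:R : R))%:E := @lebesgue_measure_bnd R _ _ false false nn.
by rewrite [X in (X * _)%E]JE [X in (_ * X)%E]JE -EFinM ltry.
Qed.

(* A named constant, because the sigma-finite structure is not inferred on the
   bare product measure. *)
Definition plane_area : set plane -> \bar R := (mu \x mu)%E.
HB.instance Definition _ := Measure.on plane_area.
HB.instance Definition _ := Measure_isSigmaFinite.Build _ _ _ plane_area sigma_finite_area.

End area_sigma_finite.

Section reflection.
Context (R : realType).
Local Notation mu := (@lebesgue_measure R).

(** At each vertex one adjacent side is parametrized towards it and the other away from it, whereas
    [corner] counts both towards it. This reflects the variable of P when its side leads away. *)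
Lemma has_integral_opp (h : R -> \bar R) (l r v : R) :
  (forall x, 0 <= h x)%E -> has_integral h (- r) (- l) v ->
  has_integral (fun x => h (- x)) l r v.
Proof.
move=> h0 hv; have [lr mh _] := hv.
have mh' : measurable_fun (`]- r, - l[%classic : set (measurableTypeR R)) h.
  exact/emeasurable_fun_itv_bndo_bndcP.
have mN : measurable_fun (`]l, r[%classic : set (measurableTypeR R)) (fun x : measurableTypeR R => h (- (x : R))).
  apply: (@measurable_comp _ _ _ _ _ _ (`]- r, - l[%classic : set (measurableTypeR R)) h
    _ (-%R : measurableTypeR R -> measurableTypeR R)) => //.
  by move=> _ [x /= + <-]; rewrite !in_itv/= !ltrN2 andbC.
split; [by rewrite -lerN2|exact/emeasurable_fun_itv_bndo_bndcP|].
rewrite integral_itv_bndoo// -(@has_integral_bnd _ h (- r) (- l) v false true hv).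
rewrite [LHS]integral_mkcond [RHS]integral_mkcond.
rewrite [RHS](@ge0_integral_affine _ (-1) 0)//.
- rewrite normrN1 mul1e; apply: eq_integral => x _.
  rewrite !patchE !mem_setE !in_itv/= mulN1r addr0 !ltrN2 andbC.
  by [].
- exact: ((measurable_restrictT h (measurable_itv _)).1 mh').
- by move=> x; rewrite patchE; case: ifP.
Qed.

End reflection.

(** * Two points on adjacent sides *)

Section adjacent_sides.
Context (R : realType).
Local Notation mu := (@lebesgue_measure R).
Implicit Types (p v s x y t u : R).

(* With [v = cot (V / 2)], this is a positive multiple of <P, Q> when P and Q
   lie on the two sides at V, at signed distances [x] and [y] (in units of the
   inradius) from the tangent points, counted positively towards V. *)
Definition corner v x y := (v ^+ 2 - 1) * (x * y - 1) + 2 * v * (x + y).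

(** The hyperbola [corner v x y = 0] solved for y. As (v^2 - 1) / (2 v) = cot V, it is tan (pi/2 - V
    - arctan x): the directions of P and Q from I differ by pi - V - arctan x - arctan y. *)
Definition corner_bound v x := ((v ^+ 2 - 1) - 2 * v * x) / ((v ^+ 2 - 1) * x + 2 * v).

(** An affine function of x, with values (v^2 + 1) / v and v (v^2 + 1) at the two ends. The proof
    splits on the sign of its slope. *)
Lemma corner_den_gt0 v x : 0 < v -> - v^-1 <= x <= v -> 0 < (v ^+ 2 - 1) * x + 2 * v.
Proof.
move=> v0 /andP[h1 h2].
have h3 : -1 <= v * x by rewrite -ler_pdivrMl// mulrN1.
rewrite -(pmulr_rgt0 _ v0).
have [h|h] := leP 1 (v ^+ 2).
  have : 0 <= (v ^+ 2 - 1) * (v * x + 1) by rewrite mulr_ge0; lra.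
  have : 0 < v ^+ 2 by rewrite exprn_gt0.
  nra.
have : 0 <= (1 - v ^+ 2) * (v - x) by rewrite mulr_ge0; lra.
have : 0 < v * v ^+ 2 by rewrite mulr_gt0// exprn_gt0.
have : 0 < v * v by rewrite mulr_gt0.
nra.
Qed.

Lemma corner_boundE v x y : 0 < v -> - v^-1 <= x <= v ->
  (corner v x y <= 0) = (y <= corner_bound v x).
Proof.
move=> v0 /(corner_den_gt0 v0) h; rewrite /corner_bound ler_pdivlMr// /corner -[RHS]subr_le0.
by congr (_ <= 0); ring.
Qed.

(** [corner] is affine in each variable, so its sign on the rectangle follows from that at the four
    corners. It vanishes at (-1/v, v), where Q is the vertex V; at (-p, -s) the relation between p,
    v, s gives p + s = v (p s - 1). Thus a P with x <= -1/v is paired with the whole other side. *)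
Lemma corner_le0 p v s x y : 0 < p -> 0 < v -> 0 < s -> p * v * s = p + v + s ->
  - p <= x <= - v^-1 -> - s <= y <= v -> corner v x y <= 0.
Proof.
move=> p0 v0 s0 pvs /andP[x1 x2] /andP[y1 y2].
have ps : 0 <= p * s - 1 by rewrite -(pmulr_rge0 _ v0); nra.
have pv : 0 < p - v^-1.
  rewrite -(pmulr_rgt0 _ v0) mulrBr divff ?gt_eqF// -(pmulr_rgt0 _ s0); nra.
have v1 : 0 < v ^+ 2 + 1 by rewrite addr_gt0// exprn_gt0.
rewrite -(pmulr_rle0 _ (addr_gt0 v0 s0)).
have -> : (v + s) * corner v x y = (y + s) * corner v x v + (v - y) * corner v x (- s).
  by rewrite /corner; ring.
have h1 : corner v x v <= 0.
  have -> : corner v x v = (v ^+ 2 + 1) * (v * (x + v^-1)) by rewrite /corner; field; lra.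
  by rewrite pmulr_rle0// pmulr_rle0//; lra.
have h2 : corner v x (- s) <= 0.
  rewrite -(pmulr_rle0 _ pv).
  have -> : (p - v^-1) * corner v x (- s) =
      - ((x + p) * ((v ^+ 2 + 1) * (1 + s / v)) +
         (- v^-1 - x) * (2 * v * (p + s) - (v ^+ 2 - 1) * (p * s - 1))).
    by rewrite /corner; field; lra.
  have -> : p + s = v * (p * s - 1) by lra.
  have -> : 2 * v * (v * (p * s - 1)) - (v ^+ 2 - 1) * (p * s - 1) =
    (v ^+ 2 + 1) * (p * s - 1) by ring.
  have sv : 0 < s / v by rewrite divr_gt0.
  by rewrite oppr_le0 addr_ge0// mulr_ge0//; try lra; rewrite mulr_ge0//; lra.
have : 0 <= (y + s) * - corner v x v by rewrite mulr_ge0; lra.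
have : 0 <= (v - y) * - corner v x (- s) by rewrite mulr_ge0; lra.
lra.
Qed.

(** Hence for x in [-1/v, v] the bound falls within the other side and the section has length s +
    [corner_bound v x]. The lower estimate again interpolates [corner] between the two ends in x. *)
Lemma corner_bound_itv v s x : 0 < v -> 0 < s -> 1 <= v * s ->
  - v^-1 <= x <= v -> - s <= corner_bound v x <= v.
Proof.
move=> v0 s0 vs xv; have := xv => /andP[x1 x2].
have v1 : 0 < v ^+ 2 + 1 by rewrite addr_gt0// exprn_gt0.
have vi : 0 < v + v^-1 by rewrite addr_gt0// invr_gt0.
apply/andP; split.
  rewrite -corner_boundE// -(pmulr_rle0 _ vi).
  have -> : (v + v^-1) * corner v x (- s) =
      - ((x + v^-1) * ((v ^+ 2 + 1) * (v * s - 1)) + (v - x) * ((v ^+ 2 + 1) * (1 + s / v))).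
    by rewrite /corner; field; lra.
  have sv : 0 < s / v by rewrite divr_gt0.
  by rewrite oppr_le0 addr_ge0// mulr_ge0//; try lra; rewrite mulr_ge0//; lra.
rewrite /corner_bound ler_pdivrMr ?corner_den_gt0// -subr_ge0.
have -> : v * ((v ^+ 2 - 1) * x + 2 * v) - (v ^+ 2 - 1 - 2 * v * x) =
  (v ^+ 2 + 1) * (v * (x + v^-1)) by field; lra.
by rewrite mulr_ge0 ?mulr_ge0//; lra.
Qed.

(** Here (1 + c) / (1 - c) = v^2, so artanh c = ln v. The case v = 1 is c = 0, where [Gam] has a
    separate value; c is never 1 or -1. *)
Lemma Gam_half_angle v : 0 < v -> v != 1 ->
  let c := (v ^+ 2 - 1) / (v ^+ 2 + 1) in
  Gam c = 1 / c - (1 - c ^+ 2) / c ^+ 2 * ln v.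
Proof.
move=> v0 v1 c.
have v2 : 0 < v ^+ 2 by rewrite exprn_gt0.
have k0 : v ^+ 2 - 1 != 0.
  rewrite subr_eq0 sqrf_eq1 negb_or v1/=.
  by rewrite gt_eqF// (lt_trans _ v0)// ltrN10.
have q0 : v ^+ 2 + 1 != 0 by rewrite gt_eqF// addr_gt0.
have e1 : 1 + c = 2 * v ^+ 2 / (v ^+ 2 + 1) by rewrite /c; field.
have e2 : 1 - c = 2 / (v ^+ 2 + 1) by rewrite /c; field.
have c0 : c != 0 by rewrite mulf_neq0// invr_eq0.
have c1 : c != 1.
  by rewrite eq_sym -subr_eq0 e2 mulf_neq0 ?invr_eq0// pnatr_eq0.
have c2 : c != -1.
  by rewrite -subr_eq0 opprK addrC e1 !mulf_neq0 ?invr_eq0 ?pnatr_eq0// gt_eqF.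
rewrite /Gam (negbTE c0) (negbTE c1) (negbTE c2); congr (_ - _ * _).
rewrite /artanh e1 e2 (_ : _ / _ / _ = v ^+ 2); last by field; rewrite q0.
by rewrite lnXn// -[ln v *+ 2]mulr_natl; field.
Qed.

Lemma corner_bound_continuous v s x : 0 < v -> - v^-1 <= x <= v ->
  {for x, continuous (fun x => s + corner_bound v x)}.
Proof.
move=> v0 xv; have d0 := corner_den_gt0 v0 xv.
apply: cvgD; first exact: cvg_cst.
apply: cvgM.
  by apply: cvgB; [exact: cvg_cst|apply: cvgM; [exact: cvg_cst|exact: cvg_id]].
apply: cvgV; first by rewrite gt_eqF.
by apply: cvgD; [apply: cvgM; [exact: cvg_cst|exact: cvg_id]|exact: cvg_cst].
Qed.

(** The section is the whole side up to -1/v and is cut by the hyperbola afterwards. The function h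
    is abstract because P may be on either of the two sides at V. *)
Lemma corner_has_integral p v s (h : R -> \bar R) :
  0 < p -> 0 < v -> 0 < s -> p * v * s = p + v + s ->
  (forall x, 0 <= h x)%E ->
  (forall x, - p < x < - v^-1 -> h x = (v + s)%:E) ->
  (forall x, - v^-1 < x < v -> h x = (s + corner_bound v x)%:E) ->
  has_integral h (- p) v (p * v + v * s + s * p - 1
    - 2 * Gam ((v ^+ 2 - 1) / (v ^+ 2 + 1)) + 2 * ln v).
Proof.
move=> p0 v0 s0 pvs h0 hl hr.
have vi : 0 < v^-1 by rewrite invr_gt0.
have pv : v^-1 <= p.
  by rewrite -[leLHS]mul1r ler_pdivrMr// -subr_ge0 -(pmulr_rge0 _ s0); nra.
have hl' : has_integral h (- p) (- v^-1) ((v + s) * (p - v^-1)).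
  apply: (@has_integral_ftc _ _ (fun=> v + s) (fun x => (v + s) * x)) => //.
  - by rewrite lerN2.
  - by move=> x _; apply: is_derive_eq; rewrite /GRing.scale/=; ring.
  - by move=> x _; exact: cst_continuous.
  - by ring.
have lr : - v^-1 <= v by lra.
have hr' : has_integral h (- v^-1) v (s * (v + v^-1)
    - 2 * Gam ((v ^+ 2 - 1) / (v ^+ 2 + 1)) + 2 * ln v).
  (* A right angle: the bound is -x, and no logarithm appears. *)
  have [v1|v1] := eqVneq v 1.
    apply: (@has_integral_ftc _ _ (fun x => s + corner_bound v x)
      (fun x => s * x - x ^+ 2 / 2)) => //.
    - move=> x _; apply: is_derive_eq; rewrite /GRing.scale/= /corner_bound v1.
      by field.
    - by move=> x xv; exact: corner_bound_continuous.
    - by rewrite v1 expr1n subrr mul0r /Gam eqxx ln1; field.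
  set k := v ^+ 2 - 1.
  have v2 : 0 < v ^+ 2 by rewrite exprn_gt0.
  have k0 : k != 0.
    rewrite subr_eq0 sqrf_eq1 negb_or v1/=.
    by rewrite gt_eqF// (lt_trans _ v0)// ltrN10.
  have q0 : v ^+ 2 + 1 != 0 by rewrite gt_eqF// addr_gt0.
  (* Partial fractions, with k^2 + 4 v^2 = (v^2 + 1)^2. For c = k / (v^2 + 1) the bound integrates
     to -2 / c + 2 ln v / c^2, which is -2 Gamma(c) + 2 ln v. *)
  apply: (@has_integral_ftc _ _ (fun x => s + corner_bound v x)
    (fun x => (s - 2 * v / k) * x +
       (v ^+ 2 + 1) ^+ 2 / k ^+ 2 * ln (k * x + 2 * v))).
  - exact: lr.
  - exact: hr.
  - move=> x xv; have d0 := corner_den_gt0 v0 xv.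
    have dl := is_derive_affine_ln d0.
    apply: is_derive_eq; rewrite /GRing.scale/= /corner_bound -/k.
    have d1 : k * x + 2 * v != 0 by rewrite gt_eqF.
    have -> : k = v ^+ 2 - 1 by [].
    by field; rewrite -/k k0 d1.
  - by move=> x xv; exact: corner_bound_continuous.
  rewrite Gam_half_angle//.
  have -> : k * v + 2 * v = v * (v ^+ 2 + 1) by rewrite /k; ring.
  have -> : k * - v^-1 + 2 * v = (v ^+ 2 + 1) / v by rewrite /k; field; lra.
  rewrite lnM ?posrE ?ln_div ?posrE//; try lra.
  rewrite -/k; have vN0 : v != 0 by rewrite gt_eqF.
  have kE : v ^+ 2 = k + 1 by rewrite /k; ring.
  by rewrite /k; field; rewrite -/k k0 q0 vN0.
have -> : p * v + v * s + s * p - 1 - 2 * Gam ((v ^+ 2 - 1) / (v ^+ 2 + 1)) + 2 * ln v =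
  (v + s) * (p - v^-1) + (s * (v + v^-1)
    - 2 * Gam ((v ^+ 2 - 1) / (v ^+ 2 + 1)) + 2 * ln v) by field; lra.
exact: has_integral_cat hl' hr'.
Qed.

Lemma corner_has_integral_fst p v s : 0 < p -> 0 < v -> 0 < s -> p * v * s = p + v + s ->
  has_integral (fun t => mu [set u : R | - v <= u < s /\ corner v t (- u) <= 0]) (- p) v
    (p * v + v * s + s * p - 1 - 2 * Gam ((v ^+ 2 - 1) / (v ^+ 2 + 1)) + 2 * ln v).
Proof.
move=> p0 v0 s0 pvs.
have vs : 1 <= v * s by rewrite -subr_ge0 -(pmulr_rge0 _ p0); nra.
apply: corner_has_integral => // t /andP[t1 t2].
  rewrite (_ : [set u | _] = `[- v, s[%classic).
    by rewrite lebesgue_measure_bnd ?opprK 1?addrC//; lra.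
  rewrite predeqE => u /=; rewrite in_itv/=; split=> [[]//|uv]; split => //.
  by apply: (corner_le0 p0 v0 s0 pvs); move/andP: uv => [u1 u2]; lra.
have tv : - v^-1 <= t <= v by rewrite !ltW.
have /andP[b1 b2] := corner_bound_itv v0 s0 vs tv.
rewrite (_ : [set u | _] = `[- corner_bound v t, s[%classic).
  by rewrite lebesgue_measure_bnd ?opprK//; lra.
rewrite predeqE => u /=; rewrite in_itv/= corner_boundE// (lerNl u).
by split=> [[/andP[_ ->] ->]//|/andP[u1 ->]]; rewrite u1; split => //; rewrite andbT; lra.
Qed.

Lemma corner_has_integral_snd p v s : 0 < p -> 0 < v -> 0 < s -> p * v * s = p + v + s ->
  has_integral (fun t => mu [set u : R | - s <= u < v /\ corner v (- t) u <= 0]) (- v) p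
    (p * v + v * s + s * p - 1 - 2 * Gam ((v ^+ 2 - 1) / (v ^+ 2 + 1)) + 2 * ln v).
Proof.
move=> p0 v0 s0 pvs.
have vs : 1 <= v * s by rewrite -subr_ge0 -(pmulr_rge0 _ p0); nra.
apply: (has_integral_opp (h := fun x : R => mu [set u : R | (- s <= u < v)%R /\ (corner v x u <= 0)%R])) => //.
rewrite opprK; apply: corner_has_integral => // t /andP[t1 t2].
  rewrite (_ : [set u | _] = `[- s, v[%classic).
    by rewrite lebesgue_measure_bnd ?opprK//; lra.
  rewrite predeqE => u /=; rewrite in_itv/=; split=> [[]//|uv]; split => //.
  by apply: (corner_le0 p0 v0 s0 pvs); move/andP: uv => [u1 u2]; lra.
have tv : - v^-1 <= t <= v by rewrite !ltW.
have /andP[b1 b2] := corner_bound_itv v0 s0 vs tv.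
(* The range of u excludes its right end v, so the section is closed on the right only if the bound
   is below v. *)
have [b3|b3] := eqVneq (corner_bound v t) v.
  rewrite (_ : [set u | _] = `[- s, v[%classic).
    by rewrite lebesgue_measure_bnd ?opprK ?b3 1?addrC//; lra.
  rewrite predeqE => u /=; rewrite in_itv/= corner_boundE// b3.
  by split=> [[]//|/andP[-> uv]]; split => //; rewrite ltW.
have b4 : corner_bound v t < v by rewrite lt_neqAle b3.
rewrite (_ : [set u | _] = `[- s, corner_bound v t]%classic).
  by rewrite lebesgue_measure_bnd// opprK addrC.
rewrite predeqE => u /=; rewrite in_itv/= corner_boundE//.
by split=> [[/andP[-> _] ->]//|/andP[-> u2]]; rewrite u2; split => //=; lra.
Qed.

End adjacent_sides.

(** * Geometry of a tangential triangle *)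

Section frame.
Context (R : realType).
Implicit Types (I F u v w p : R * R) (x y t a b c r : R).

(* Coordinates of the point in the frame (F, rot F) centred at I; the line
   tangent to the incircle at I + F is [x = 1]. *)
Definition pt I F x y : R * R := I + x *: F + y *: rot F.

Lemma pt_eq I F (x y x' y' : R) : x = x' -> y = y' -> pt I F x y = pt I F x' y'.
Proof. by move=> -> ->. Qed.

Lemma ptE I F x y : pt I F x y = (I.1 + x * F.1 - y * F.2, I.2 + x * F.2 + y * F.1).
Proof. by rewrite /pt /rot; case: I F => [i1 i2] [f1 f2]; congr (_, _); rewrite /= [RHS]/= -?mulrN. Qed.

Lemma vec_eq u v : u.1 = v.1 -> u.2 = v.2 -> u = v.
Proof. by case: u v => ? ? [? ?] /= -> ->. Qed.

Lemma fst_scale x u : (x *: u).1 = x * u.1. Proof. by []. Qed.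
Lemma snd_scale x u : (x *: u).2 = x * u.2. Proof. by []. Qed.
Lemma fst_add u v : (u + v).1 = u.1 + v.1. Proof. by []. Qed.
Lemma snd_add u v : (u + v).2 = u.2 + v.2. Proof. by []. Qed.
Lemma fst_opp u : (- u).1 = - u.1. Proof. by []. Qed.
Lemma snd_opp u : (- u).2 = - u.2. Proof. by []. Qed.
Definition vecE := (fst_scale, snd_scale, fst_add, snd_add, fst_opp, snd_opp).

Lemma dotC u v : dot u v = dot v u.
Proof. by rewrite /dot; ring. Qed.

Lemma dot_pt I F x y x' y' :
  dot (pt I F x y - I) (pt I F x' y' - I) = (x * x' + y * y') * dot F F.
Proof. by rewrite !ptE /dot !vecE/=; ring. Qed.

Lemma dot_foot I F x y : dot (pt I F x y - I) F = x * dot F F.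
Proof. by rewrite !ptE /dot !vecE/=; ring. Qed.

Lemma pt_surj I F p : dot F F != 0 -> exists x y, p = pt I F x y.
Proof.
move=> F0; exists (dot (p - I) F / dot F F), (dot (p - I) (rot F) / dot F F).
rewrite ptE; apply: vec_eq; rewrite /= /dot /rot !vecE/=; move: F0; rewrite /dot => F0; field; exact: F0.
Qed.

Lemma pt_inj I F x y x' y' : dot F F != 0 -> pt I F x y = pt I F x' y' -> x = x' /\ y = y'.
Proof.
move=> F0 E; split.
  have := congr1 (fun p => dot (p - I) F) E; rewrite !dot_foot.
  by move=> /(mulIf F0).
have := congr1 (fun p => dot (p - I) (pt I F 0 1 - I)) E; rewrite !dot_pt !mulr0 !add0r !mulr1.
by move=> /(mulIf F0).
Qed.

End frame.

(** * From tangency to half-angle cotangents *)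

Section tangency.
Context (R : realType).
Implicit Types (A B C I F U V M p : R * R) (x y t a b c r : R).

(** Reflecting the common point X in the foot of the perpendicular from I gives another point of the
    line at distance r from I. Uniqueness identifies it with X, so X is that foot and the line is x
    = 1 in the frame of X - I. *)
Lemma tangent_line_foot U V I r : 0 < r -> U != V -> tangent I r (line U V) ->
  exists F x y, [/\ dot F F = r ^+ 2, U = pt I F 1 x, V = pt I F 1 y & Defs.edist I (I + F) = r].
Proof.
move=> r0 UV [X [[[t Xt] dX] Xuniq]].
pose D := V - U.
have D0 : dot D D != 0.
  rewrite /dot -!expr2 paddr_eq0 ?sqr_ge0// !sqrf_eq0.
  apply: contra UV => /andP[/eqP d1 /eqP d2].
  by apply/eqP; apply: vec_eq; apply/eqP; rewrite eq_sym -subr_eq0; apply/eqP.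
have FF : dot (X - I) (X - I) = r ^+ 2.
  by rewrite -dX /Defs.edist sqr_sqrtr// /dot -!expr2 addr_ge0 ?sqr_ge0.
(* The displacement from X to its mirror image along D. *)
pose k := - 2 * dot (X - I) D / dot D D.
have kD : k * dot D D = - 2 * dot (X - I) D by rewrite /k divfK.
pose Y : R * R := X + k *: D.
have YI : dot (Y - I) (Y - I) = dot (X - I) (X - I).
  transitivity (dot (X - I) (X - I) + k * (k * dot D D + 2 * dot (X - I) D)).
    by rewrite /Y /dot !vecE; ring.
  by rewrite kD mulNr addNr mulr0 addr0.
have XY : X = Y.
  apply: Xuniq; split; last by rewrite -dX /Defs.edist YI.
  exists (t + k); rewrite /Y {1}Xt /D.
  by apply: vec_eq; rewrite !vecE; (ring || lra).
have perp : dot (X - I) D = 0.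
  have : k = 0.
    have /eqP : k * dot D D = 0.
      have -> : k * dot D D = dot (Y - X) D by rewrite /Y /dot !vecE; ring.
      by rewrite -XY subrr /dot /= !mul0r addr0.
    by rewrite mulf_eq0 (negbTE D0) orbF => /eqP.
  by move=> k0; move: kD; rewrite k0 mul0r; lra.
have F0 : dot (X - I) (X - I) != 0 by rewrite FF expf_neq0// gt_eqF.
have [x1 [x2 Ux]] := pt_surj I U F0.
have [y1 [y2 Vy]] := pt_surj I V F0.
have DE : dot (X - I) D = (y1 - x1) * r ^+ 2.
  by rewrite -FF /D Ux Vy !ptE /dot !vecE/=; ring.
have xy : x1 = y1.
  move: perp; rewrite DE => /eqP; rewrite mulf_eq0 expf_eq0/= (gt_eqF r0) orbF subr_eq0.
  by move=> /eqP.
have x11 : x1 = 1.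
  have : dot (X - I) (X - I) = x1 * dot (X - I) (X - I).
    rewrite -(dot_foot I _ x1 x2).
    rewrite -Ux.
    have XU : X = U + t *: D by rewrite Xt /D; apply: vec_eq; rewrite !vecE; (ring || lra).
    have -> : dot (U - I) (X - I) = dot (X - I) (X - I) - t * dot (X - I) D.
      by rewrite XU /dot !vecE; ring.
    by rewrite perp mulr0 subr0.
  by rewrite -[LHS]mul1r => /(mulIf F0).
exists (X - I), x2, y2; split => //.
- by rewrite Ux x11.
- by rewrite Vy -xy x11.
- by rewrite addrC subrK.
Qed.

Lemma collinear_pt A B C I F a b c :
  A = pt I F 1 a -> B = pt I F 1 b -> C = pt I F 1 c -> collinear A B C.
Proof.
move=> -> -> ->; exists (pt I F 1 0), (pt I F 1 1).
by split; [exists a|exists b|exists c]; rewrite !ptE; apply: vec_eq; rewrite !vecE/=; ring.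
Qed.

(* The two tangents through a point off the circle touch it at points placed
   symmetrically, so their tangent parameters are opposite. *)
Lemma tangent_params A I F G x y r : 0 < r -> dot F F = r ^+ 2 -> dot G G = r ^+ 2 ->
  F != G -> A = pt I F 1 x -> A = pt I G 1 y -> y = - x /\ x != 0.
Proof.
move=> r0 FF GG FG AF AG.
have r2 : r ^+ 2 != 0 by rewrite expf_neq0// gt_eqF.
have E : x ^+ 2 = y ^+ 2.
  have : dot (A - I) (A - I) = dot (A - I) (A - I) by [].
  rewrite {1 2}AF AG !dot_pt FF GG => /(mulIf r2); rewrite !mul1r -!expr2.
  by move=> /addrI.
(* In complex notation A - I = (1 + i z) F, so A and z determine F. *)
have key z : A = pt I F 1 z -> A = pt I G 1 z -> F = G.
  move=> h1 h2; have : pt I F 1 z = pt I G 1 z by rewrite -h1 -h2.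
  rewrite !ptE => -[e1 e2].
  have z1 : 1 + z ^+ 2 != 0 by rewrite gt_eqF// ltr_pwDl// sqr_ge0.
  apply: vec_eq; apply: (mulfI z1).
    have -> : (1 + z ^+ 2) * F.1 = (I.1 + 1 * F.1 - z * F.2 - I.1) + z * (I.2 + 1 * F.2 + z * F.1 - I.2) by ring.
    by rewrite e1 e2; ring.
  have -> : (1 + z ^+ 2) * F.2 = (I.2 + 1 * F.2 + z * F.1 - I.2) - z * (I.1 + 1 * F.1 - z * F.2 - I.1) by ring.
  by rewrite e1 e2; ring.
have yx : y = - x.
  move/eqP: E; rewrite eqf_sqr => /orP[/eqP xy|/eqP ->]; last by rewrite opprK.
  by move: FG; rewrite (key x AF) ?eqxx// xy.
split=> //; apply: contra FG => /eqP x0; apply/eqP; apply: (key 0); first by rewrite -x0.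
by rewrite AG yx x0 oppr0.
Qed.

(* [I + F] is the tangent point on AB; it lies between A and B since the
   incircle is contained in the triangle. *)
Lemma tangent_params_sign A B C I F a b r : 0 < r -> dot F F = r ^+ 2 ->
  ~ collinear A B C -> triangle A B C (I + F) ->
  A = pt I F 1 (- a) -> B = pt I F 1 b -> a != 0 -> b != 0 -> 0 < a * b.
Proof.
move=> r0 FF ncol [x [y [z [x0 y0 z0 xyz E]]]] AE BE a0 b0.
have F0 : dot F F != 0 by rewrite FF expf_neq0// gt_eqF.
have [c1 [c2 CE]] := pt_surj I C F0.
have : pt I F 1 0 = pt I F (x + y + z * c1) (- (a * x) + b * y + z * c2).
  have -> : pt I F 1 0 = I + F by rewrite /pt scale1r scale0r addr0.
  have zE : z = 1 - x - y by lra.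
  by rewrite {1}E AE BE CE zE !ptE; apply: vec_eq; rewrite !vecE/=; ring.
move=> /(pt_inj F0)[e1 e2].
have c11 : c1 != 1.
  by apply/eqP => c11; apply: ncol; apply: collinear_pt AE BE _; rewrite CE c11.
(* C is off the tangent line while A, B and the tangent point are on it, so C has weight 0. *)
have z00 : z = 0.
  have : z * (c1 - 1) = 0 by lra.
  by move/eqP; rewrite mulf_eq0 subr_eq0 (negbTE c11) orbF => /eqP.
rewrite z00 !mul0r !addr0 in e1 e2 xyz.
rewrite lt_neqAle eq_sym mulf_neq0//= leNgt; apply/negP => ab.
have e3 : a * x = b * y by lra.
have h1 : a * b * x = b ^+ 2 * y by rewrite mulrAC e3; ring.
have h2 : a * b * y = a ^+ 2 * x by rewrite -mulrA -e3; ring.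
have : 0 <= b ^+ 2 * y by rewrite mulr_ge0// sqr_ge0.
have : 0 <= a ^+ 2 * x by rewrite mulr_ge0// sqr_ge0.
rewrite -h1 -h2 => h3 h4.
have : 0 <= a * b by rewrite -[a * b]mulr1 e1 mulrDr addr_ge0.
by rewrite leNgt ab.
Qed.

(* Positively oriented; [F3], [F1], [F2] point from I to the tangent points on
   AB, BC, CA, and [a], [b], [c] are the cotangents of the half angles. *)
Definition tangential (A B C I F3 F1 F2 : R * R) (a b c r : R) :=
  [/\ [/\ 0 < r, 0 < a, 0 < b & 0 < c],
      [/\ dot F3 F3 = r ^+ 2, dot F1 F1 = r ^+ 2 & dot F2 F2 = r ^+ 2],
      A = pt I F3 1 (- a) /\ A = pt I F2 1 a,
      B = pt I F1 1 (- b) /\ B = pt I F3 1 b &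
      C = pt I F2 1 (- c) /\ C = pt I F1 1 c].

Lemma tangential_rot A B C I F3 F1 F2 a b c r :
  tangential A B C I F3 F1 F2 a b c r -> tangential B C A I F1 F2 F3 b c a r.
Proof. by move=> [[? ? ? ?] [? ? ?] [? ?] [? ?] [? ?]]; split. Qed.

(** The tangent points are distinct, since two equal ones would put A, B, C on one line. The two
    parameters at a vertex are opposite and the products along sides are positive, so a, b, c share
    a sign, which is the orientation of the triangle. *)
Lemma tangential_exists A B C I r : ~ collinear A B C -> is_incircle A B C I r ->
  exists F3 F1 F2 a b c,
    tangential A B C I F3 F1 F2 a b c r \/ tangential A C B I F2 F1 F3 a c b r.
Proof.
move=> ncol [r0 disk tBC tCA tAB].
have ncolrot : ~ collinear B C A by move=> [U [V [? ? ?]]]; apply: ncol; exists U, V.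
have ncolrot' : ~ collinear C A B by move=> [U [V [? ? ?]]]; apply: ncol; exists U, V.
have neq (X Y Z : R * R) : ~ collinear X Y Z -> X != Y.
  move=> nc; apply/eqP => XY; apply: nc; exists X, Z; split.
  - by exists 0; rewrite subr0 scale1r scale0r addr0.
  - by exists 0; rewrite subr0 scale1r scale0r addr0 XY.
  - by exists 1; rewrite subrr scale1r scale0r add0r.
have trirot : triangle A B C `<=` triangle B C A.
  move=> X [x [y [z [? ? ? ? ->]]]]; exists y, z, x; split => //; first lra.
  by apply: vec_eq; rewrite !vecE; ring.
have trirot' : triangle A B C `<=` triangle C A B.
  move=> X [x [y [z [? ? ? ? ->]]]]; exists z, x, y; split => //; first lra.
  by apply: vec_eq; rewrite !vecE; ring.
have [F1 [b1 [c1 [FF1 B1 C1 d1]]]] := tangent_line_foot r0 (neq _ _ _ ncolrot) tBC.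
have [F2 [c2 [a2 [FF2 C2 A2 d2]]]] := tangent_line_foot r0 (neq _ _ _ ncolrot') tCA.
have [F3 [a3 [b3 [FF3 A3 B3 d3]]]] := tangent_line_foot r0 (neq _ _ _ ncol) tAB.
have F32 : F2 != F3.
  by apply/eqP => E; apply: ncol; apply: collinear_pt A3 B3 _; rewrite -E; exact: C2.
have F13 : F3 != F1.
  by apply/eqP => E; apply: ncol; apply: collinear_pt A3 B3 _; rewrite E; exact: C1.
have F21 : F1 != F2.
  by apply/eqP => E; apply: ncolrot; apply: collinear_pt B1 C1 _; rewrite E; exact: A2.
have [Ea a0] := tangent_params r0 FF2 FF3 F32 A2 A3.
have [Eb b0] := tangent_params r0 FF3 FF1 F13 B3 B1.
have [Ec c0] := tangent_params r0 FF1 FF2 F21 C1 C2.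
rewrite Ea in A3; rewrite Eb in B1; rewrite Ec in C2.
have ab : 0 < a2 * b3.
  by apply: (tangent_params_sign r0 FF3 ncol _ A3 B3) => //; apply: disk; rewrite /closed_disk/= d3.
have bc : 0 < b3 * c1.
  by apply: (tangent_params_sign r0 FF1 ncolrot _ B1 C1) => //; apply: trirot; apply: disk; rewrite /closed_disk/= d1.
have [apos|aneg] : 0 < a2 \/ a2 < 0 by case: (ltgtP a2 0) a0 => //; [right|left].
  have bpos : 0 < b3 by rewrite -(pmulr_rgt0 _ apos).
  have cpos : 0 < c1 by rewrite -(pmulr_rgt0 _ bpos).
  by exists F3, F1, F2, a2, b3, c1; left; split.
have bneg : b3 < 0 by rewrite -(nmulr_rgt0 _ aneg).
have cneg : c1 < 0 by rewrite -(nmulr_rgt0 _ bneg).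
(* Negative orientation: exchanging B and C reverses every side, hence negates its parameters. *)
exists F3, F1, F2, (- a2), (- b3), (- c1); right; split; rewrite ?opprK ?oppr_gt0//; split=> //; rewrite oppr_gt0.
Qed.

End tangency.

Section change_frame.
Context (R : realType).
Implicit Types (I F G u v p : R * R) (x y t b r : R).

(* The hypothesis says that G is F rotated by twice the angle of tangent b. *)
Lemma pt_rotate I F G b x y : pt I G 1 (- b) = pt I F 1 b ->
  pt I G x y = pt I F (((1 - b ^+ 2) * x - 2 * b * y) / (1 + b ^+ 2))
                      ((2 * b * x + (1 - b ^+ 2) * y) / (1 + b ^+ 2)).
Proof.
have b1 : 1 + b ^+ 2 != 0 by rewrite gt_eqF// ltr_pwDl// sqr_ge0.
rewrite !ptE => -[e1 e2].
have g1 : (1 + b ^+ 2) * G.1 = (1 - b ^+ 2) * F.1 - 2 * b * F.2.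
  have -> : (1 + b ^+ 2) * G.1 = (I.1 + 1 * G.1 - - b * G.2 - I.1) - b * (I.2 + 1 * G.2 + - b * G.1 - I.2) by ring.
  by rewrite e1 e2; ring.
have g2 : (1 + b ^+ 2) * G.2 = (1 - b ^+ 2) * F.2 + 2 * b * F.1.
  have -> : (1 + b ^+ 2) * G.2 = (I.2 + 1 * G.2 + - b * G.1 - I.2) + b * (I.1 + 1 * G.1 - - b * G.2 - I.1) by ring.
  by rewrite e1 e2; ring.
have {}g1 : G.1 = ((1 - b ^+ 2) * F.1 - 2 * b * F.2) / (1 + b ^+ 2) by rewrite -g1 mulrAC divff ?mul1r.
have {}g2 : G.2 = ((1 - b ^+ 2) * F.2 + 2 * b * F.1) / (1 + b ^+ 2) by rewrite -g2 mulrAC divff ?mul1r.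
by rewrite g1 g2; apply: vec_eq; rewrite /=; field.
Qed.

(** Links [corner] to the geometry. The sign of u changes because u grows away from the common
    vertex. *)
Lemma dot_adjacent I F G b t (u : R) : pt I G 1 (- b) = pt I F 1 b ->
  dot (pt I F 1 t - I) (pt I G 1 u - I) = corner b t (- u) * dot F F / (1 + b ^+ 2).
Proof.
move=> FG; have b1 : 1 + b ^+ 2 != 0 by rewrite gt_eqF// ltr_pwDl// sqr_ge0.
by rewrite (pt_rotate _ _ FG) dot_pt /corner; field.
Qed.

Definition det u v := u.1 * v.2 - u.2 * v.1.

Lemma det_pt I F x y x' y' :
  det (pt I F x y - I) (pt I F x' y' - I) = (x * y' - y * x') * dot F F.
Proof. by rewrite !ptE /dot /det !vecE/=; ring. Qed.

End change_frame.

(** * The triangle in terms of the half-angle cotangents *)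

Section tangential_triangle.
Context (R : realType).
Variables (A B C I F3 F1 F2 : R * R) (a b c r : R).
Hypothesis T : tangential A B C I F3 F1 F2 a b c r.

Let r0 : 0 < r. Proof. by case: T => -[]. Qed.
Let a0 : 0 < a. Proof. by case: T => -[]. Qed.
Let b0 : 0 < b. Proof. by case: T => -[]. Qed.
Let c0 : 0 < c. Proof. by case: T => -[]. Qed.
Let F3r : dot F3 F3 = r ^+ 2. Proof. by case: T => _ []. Qed.
Let A3 : A = pt I F3 1 (- a). Proof. by case: T => _ _ []. Qed.
Let A2 : A = pt I F2 1 a. Proof. by case: T => _ _ []. Qed.
Let B1 : B = pt I F1 1 (- b). Proof. by case: T => _ _ _ []. Qed.
Let B3 : B = pt I F3 1 b. Proof. by case: T => _ _ _ []. Qed.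
Let C2 : C = pt I F2 1 (- c). Proof. by case: T => _ _ _ _ []. Qed.
Let C1 : C = pt I F1 1 c. Proof. by case: T => _ _ _ _ []. Qed.

Let r2 : 0 < r ^+ 2. Proof. by rewrite exprn_gt0. Qed.
Let F3N0 : dot F3 F3 != 0. Proof. by rewrite F3r gt_eqF. Qed.
Let a1 : 1 + a ^+ 2 != 0. Proof. by rewrite gt_eqF// ltr_pwDl// sqr_ge0. Qed.
Let b1 : 1 + b ^+ 2 != 0. Proof. by rewrite gt_eqF// ltr_pwDl// sqr_ge0. Qed.

Lemma pt_F1 x y : pt I F1 x y = pt I F3 (((1 - b ^+ 2) * x - 2 * b * y) / (1 + b ^+ 2))
                      ((2 * b * x + (1 - b ^+ 2) * y) / (1 + b ^+ 2)).
Proof. by apply: pt_rotate; rewrite -B1. Qed.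

Lemma pt_F2 x y : pt I F2 x y = pt I F3 (((1 - a ^+ 2) * x + 2 * a * y) / (1 + a ^+ 2))
                      ((- 2 * a * x + (1 - a ^+ 2) * y) / (1 + a ^+ 2)).
Proof.
rewrite (@pt_rotate _ I F3 F2 (- a)) ?opprK -?A2//.
by apply: pt_eq; rewrite sqrrN; congr (_ / _); ring.
Qed.

(** C is computed in the frame of F3 through B and through A; equating second coordinates gives the
    relation times 1 + a b, which is positive. *)
Lemma half_angle_rel : a * b * c = a + b + c.
Proof.
have : pt I F1 1 c = pt I F2 1 (- c) by rewrite -C1.
rewrite pt_F1 pt_F2 => /(pt_inj F3N0)[_ /eqP].
rewrite eqr_div// => /eqP E.
have ab : 1 + a * b != 0 by rewrite gt_eqF// addr_gt0// mulr_gt0.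
apply: (mulfI ab); apply/eqP; rewrite -subr_eq0; apply/eqP.
have : (2 * b * 1 + (1 - b ^+ 2) * c) * (1 + a ^+ 2) - (- 2 * a * 1 + (1 - a ^+ 2) * - c) * (1 + b ^+ 2) = 0.
  by rewrite E subrr.
lra.
Qed.

Lemma tangential_ab_gt1 : 0 < a * b - 1.
Proof.
rewrite -(pmulr_rgt0 _ c0) (_ : c * _ = a + b) ?addr_gt0//.
by rewrite mulrBr mulrC half_angle_rel; ring.
Qed.

Let cE : c = (a + b) / (a * b - 1).
Proof.
have ab : a * b - 1 != 0 by rewrite gt_eqF// tangential_ab_gt1.
apply: (mulIf ab); rewrite divfK//.
by rewrite mulrBr (mulrC c) half_angle_rel; ring.
Qed.

Lemma C_pt : C = pt I F3 (- (a * b + 1) / (a * b - 1)) ((a - b) / (a * b - 1)).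
Proof.
have ab : a * b - 1 != 0 by rewrite gt_eqF// tangential_ab_gt1.
by rewrite C1 pt_F1 cE; apply: pt_eq; field; rewrite b1 ab.
Qed.

Lemma edist_AB : Defs.edist A B = r * (a + b).
Proof.
rewrite /Defs.edist; have -> : dot (B - A) (B - A) = (r * (a + b)) ^+ 2.
  by rewrite exprMn -F3r A3 B3 !ptE /dot !vecE/=; ring.
by rewrite sqrtr_sqr gtr0_norm// mulr_gt0// addr_gt0.
Qed.

Lemma dot_sides_A : dot (B - A) (C - A) =
  (r * (a + b)) * (r * (c + a)) * ((a ^+ 2 - 1) / (a ^+ 2 + 1)).
Proof.
have ab : a * b - 1 != 0 by rewrite gt_eqF// tangential_ab_gt1.
have a1' : a ^+ 2 + 1 != 0 by rewrite addrC.
have -> : dot (B - A) (C - A) = dot F3 F3 * ((a + b) * ((a - b) / (a * b - 1) + a)).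
  by rewrite C_pt A3 B3 !ptE /dot !vecE/=; ring.
by rewrite F3r cE; field; rewrite ab a1'.
Qed.

End tangential_triangle.

(** * Semiperimeter, angles and circumradius *)

Section tangential_measurements.
Context (R : realType).
Variables (A B C I F3 F1 F2 : R * R) (a b c r : R).
Hypothesis T : tangential A B C I F3 F1 F2 a b c r.

Let r0 : 0 < r. Proof. by case: T => -[]. Qed.
Let a0 : 0 < a. Proof. by case: T => -[]. Qed.
Let b0 : 0 < b. Proof. by case: T => -[]. Qed.
Let c0 : 0 < c. Proof. by case: T => -[]. Qed.

Lemma tangential_semiperimeter : semiperimeter A B C = r * (a + b + c).
Proof.
rewrite /semiperimeter (edist_AB T) (edist_AB (tangential_rot T)).
by rewrite (edist_AB (tangential_rot (tangential_rot T))); field.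
Qed.

Lemma edist_sym (U V : R * R) : Defs.edist U V = Defs.edist V U.
Proof. by rewrite /Defs.edist; congr (Num.sqrt _); rewrite /dot !vecE; ring. Qed.

Lemma angle_sym (U V W : R * R) : angle U V W = angle W V U.
Proof. by rewrite /angle dotC (mulrC (Defs.edist V U)). Qed.

Lemma cos_angle_A : cos (angle B A C) = (a ^+ 2 - 1) / (a ^+ 2 + 1).
Proof.
rewrite /angle (edist_AB T) (edist_sym A C) (edist_AB (tangential_rot (tangential_rot T))).
have h1 : r * (a + b) != 0 by rewrite gt_eqF// mulr_gt0// addr_gt0.
have h2 : r * (c + a) != 0 by rewrite gt_eqF// mulr_gt0// addr_gt0.
have a1 : 0 < a ^+ 2 + 1 by rewrite addr_gt0// exprn_gt0.
have a2 : 0 < a ^+ 2 by rewrite exprn_gt0.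
have P0 := mulf_neq0 h1 h2.
rewrite (dot_sides_A T) [X in acos (X / _)]mulrC mulfK// acosK// in_itv/=.
by apply/andP; rewrite ler_pdivlMr// ler_pdivrMr//; split; lra.
Qed.

(** The hypothesis only gives some equidistant point Z; the perpendicular bisectors of AB and AC
    determine its coordinates y and x. *)
Lemma tangential_circumradius Rc : is_circumradius A B C Rc ->
  8 * Rc / r = 2 * (a * b + b * c + c * a) - 2.
Proof.
case=> Z [OA OB OC].
have [[_ _ _ _] [F3r _ _] [A3 _] [_ B3] _] := T.
have r2 : 0 < r ^+ 2 by rewrite exprn_gt0.
have F3N0 : dot F3 F3 != 0 by rewrite F3r gt_eqF.
have [x [y Zxy]] := pt_surj I Z F3N0.
have n0 := tangential_ab_gt1 T; have rel := half_angle_rel T.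
have CE := C_pt T.
set n := a * b - 1 in n0 CE.
have nN0 : n != 0 by rewrite gt_eqF.
have sq x' y' : Defs.edist Z (pt I F3 x' y') ^+ 2 = r ^+ 2 * ((x - x') ^+ 2 + (y - y') ^+ 2).
  rewrite /Defs.edist sqr_sqrtr; last by rewrite /dot -!expr2 addr_ge0 ?sqr_ge0.
  by rewrite -F3r Zxy !ptE /dot !vecE/=; ring.
have Rc0 : 0 <= Rc by rewrite -OA sqrtr_ge0.
have eA : Rc ^+ 2 = r ^+ 2 * ((x - 1) ^+ 2 + (y + a) ^+ 2) by rewrite -OA A3 sq opprK.
have eB : Rc ^+ 2 = r ^+ 2 * ((x - 1) ^+ 2 + (y - b) ^+ 2) by rewrite -OB B3 sq.
have eC : Rc ^+ 2 = r ^+ 2 * ((x - (- (a * b + 1) / n)) ^+ 2 + (y - (a - b) / n) ^+ 2).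
  by rewrite -OC CE sq.
have ab : 0 < a + b by rewrite addr_gt0.
have yE : y = (b - a) / 2.
  have : r ^+ 2 * ((a + b) * (2 * y + a - b)) = 0.
    have : r ^+ 2 * ((x - 1) ^+ 2 + (y + a) ^+ 2) - r ^+ 2 * ((x - 1) ^+ 2 + (y - b) ^+ 2) = 0.
      by rewrite -eA -eB subrr.
    by move=> <-; ring.
  by move/eqP; rewrite mulf_eq0 (gt_eqF r2)/= mulf_eq0 (gt_eqF ab)/= => /eqP; lra.
have aN0 : a * b != 0 by rewrite gt_eqF// mulr_gt0.
have xE : x = 1 + (n ^+ 2 - (a + b) ^+ 2) / (4 * n).
  have : r ^+ 2 * (a * b / n * (4 * (x - 1) - (n ^+ 2 - (a + b) ^+ 2) / n)) = 0.
    have : r ^+ 2 * ((x - (- (a * b + 1) / n)) ^+ 2 + (y - (a - b) / n) ^+ 2)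
        - r ^+ 2 * ((x - 1) ^+ 2 + (y + a) ^+ 2) = 0.
      by rewrite -eA -eC subrr.
    move=> <-; rewrite yE /n; field.
    by rewrite -/n nN0.
  move/eqP; rewrite mulf_eq0 (gt_eqF r2)/= mulf_eq0 (gt_eqF (divr_gt0 _ n0)) ?mulr_gt0//= => /eqP h.
  have -> : (n ^+ 2 - (a + b) ^+ 2) / (4 * n) = (n ^+ 2 - (a + b) ^+ 2) / n / 4 by field.
  lra.
(* Here (n^2 - (a + b)^2)^2 + 4 n^2 (a + b)^2 is the square of n^2 + (a + b)^2; both sides are
   nonnegative, so squares may be compared. *)
have RcE : Rc = r * ((n ^+ 2 + (a + b) ^+ 2) / (4 * n)).
  apply/eqP; rewrite -(@eqrXn2 _ 2)//; last first.
    by rewrite mulr_ge0 ?divr_ge0 ?addr_ge0 ?sqr_ge0 ?mulr_ge0// ltW.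
  by apply/eqP; rewrite eA xE yE; field.
have cE : c = (a + b) / n.
  by apply: (mulIf nN0); rewrite divfK// /n mulrBr (mulrC c) rel; ring.
rewrite RcE cE.
have rN0 : r != 0 by rewrite gt_eqF.
have -> : a * b = n + 1 by rewrite /n subrK.
by field; rewrite rN0 nN0.
Qed.

End tangential_measurements.

(** * Integration over the triangle *)

Section triangle_integral.
Context (R : realType).
Local Notation mu := (@lebesgue_measure R).
Local Notation plane := (measurableTypeR R * measurableTypeR R)%type.
Local Notation parea := (mu \x mu : set plane -> \bar R)%E.
Implicit Types (A B C I F G p q u v : R * R) (x y t a b c r : R).

Lemma measurable_dot (p : R * R) (x y : R) :
  measurable_fun [set: plane] (fun z : plane => (x * (z.1 - p.1) + y * (z.2 - p.2) : R) : measurableTypeR R).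
Proof.
by apply: measurable_funD; apply: measurable_funM => //; apply: measurable_funB.
Qed.

(* The part of the triangle in the angular sector AIB; half-open, so that the
   three sectors partition the interior minus I. *)
Definition sector A B I F r : set (R * R) :=
  [set p | [/\ dot (p - I) F < r ^+ 2, 0 <= det (A - I) (p - I) & det (B - I) (p - I) < 0]].

Lemma measurable_lt0 (f : plane -> R) : measurable_fun [set: plane] (f : plane -> measurableTypeR R) ->
  measurable ([set p | f p < 0] : set plane).
Proof.
move=> mf; rewrite (_ : [set p | _] = f @^-1` `]-oo, 0[%classic).
  by rewrite -[X in measurable X]setTI; apply: mf => //; exact: measurable_itv.
by rewrite predeqE => p /=; rewrite in_itv.
Qed.

Lemma measurable_sector A B I F r : measurable (sector A B I F r : set plane).
Proof.
have -> : sector A B I F r =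
  [set p | F.1 * (p.1 - I.1) + F.2 * (p.2 - I.2) - r ^+ 2 < 0] `&`
  ~` [set p | - (A - I).2 * (p.1 - I.1) + (A - I).1 * (p.2 - I.2) < 0] `&`
  [set p | - (B - I).2 * (p.1 - I.1) + (B - I).1 * (p.2 - I.2) < 0].
  rewrite predeqE => p; rewrite /sector /dot /det /= ?vecE.
  split=> [[h1 h2 h3]|[[h1 h2] h3]].
    split; last by lra.
    by split; [lra|apply/negP; rewrite -leNgt; lra].
  move/negP: h2; rewrite -leNgt => h2.
  by split; lra.
apply: measurableI; last by apply: measurable_lt0; exact: measurable_dot.
apply: measurableI.
  by apply: measurable_lt0; apply: measurable_funB => //; exact: measurable_dot.
by apply: measurableC; apply: measurable_lt0; exact: measurable_dot.
Qed.

Lemma sectorP A B I F a b r x w : 0 < r -> 0 < a -> 0 < b -> dot F F = r ^+ 2 ->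
  A = pt I F 1 (- a) -> B = pt I F 1 b ->
  sector A B I F r (pt I F x w) <-> 0 < x < 1 /\ - a * x <= w < b * x.
Proof.
move=> r0 a0 b0 FF -> ->; rewrite /sector/= !det_pt dot_foot FF !mul1r !mulNr opprK.
have r2 : 0 < r ^+ 2 by rewrite exprn_gt0.
rewrite -[X in _ < X]mul1r ltr_pM2r// pmulr_lge0// pmulr_llt0//.
split=> [[x1 h1 h2]|[/andP[x0 x1] /andP[h1 h2]]]; last by split => //; lra.
have : 0 < (a + b) * x by lra.
rewrite pmulr_rgt0 ?addr_gt0// => x0.
by split; apply/andP; split => //; lra.
Qed.

(** An intersection of open half-planes bounded by the side lines, convenient for measurability;
    [triangle_interiorE] identifies it with the topological interior. *)
Definition tri_interior I F3 F1 F2 r : set (R * R) :=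
  [set p | [/\ dot (p - I) F3 < r ^+ 2, dot (p - I) F1 < r ^+ 2 & dot (p - I) F2 < r ^+ 2]].

Lemma tri_interior_rot I F3 F1 F2 r : tri_interior I F3 F1 F2 r = tri_interior I F1 F2 F3 r.
Proof. by rewrite predeqE => p; split=> -[]. Qed.

Section fixed_triangle.
Variables (A B C I F3 F1 F2 : R * R) (a b c r : R).
Hypothesis T : tangential A B C I F3 F1 F2 a b c r.

Lemma dot_F1 x y : dot (pt I F3 x y - I) F1 =
  ((1 - b ^+ 2) * x + 2 * b * y) / (1 + b ^+ 2) * dot F3 F3.
Proof.
have -> : F1 = pt I F1 1 0 - I by rewrite /pt scale0r scale1r addr0 addrC addKr.
by rewrite (pt_F1 T) dot_pt; ring.
Qed.

Lemma dot_F2 x y : dot (pt I F3 x y - I) F2 =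
  ((1 - a ^+ 2) * x - 2 * a * y) / (1 + a ^+ 2) * dot F3 F3.
Proof.
have -> : F2 = pt I F2 1 0 - I by rewrite /pt scale0r scale1r addr0 addrC addKr.
by rewrite (pt_F2 T) dot_pt; ring.
Qed.

(** On the ray IB, where w = b x, the conditions for F1 and F3 coincide by symmetry; away from it,
    inside the sector, the one for F1 is weaker. The same holds at A for F2. *)
Lemma sector_sub_interior : sector A B I F3 r `<=` tri_interior I F3 F1 F2 r.
Proof.
have [[r0 a0 b0 _] [FF _ _] [A3 _] [_ B3] _] := T.
have r2 : 0 < r ^+ 2 by rewrite exprn_gt0.
have F3N0 : dot F3 F3 != 0 by rewrite FF gt_eqF.
move=> p; have [x [w ->]] := pt_surj I p F3N0.
move=> /(sectorP _ _ r0 a0 b0 FF A3 B3)[/andP[x0 x1] /andP[h1 h2]].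
have q1 : 0 < 1 + b ^+ 2 by rewrite ltr_pwDl// sqr_ge0.
have q2 : 0 < 1 + a ^+ 2 by rewrite ltr_pwDl// sqr_ge0.
split.
- by rewrite dot_foot FF -[X in _ < X]mul1r ltr_pM2r.
- rewrite dot_F1 FF -[X in _ < X]mul1r ltr_pM2r// ltr_pdivrMr// mul1r.
  have : 0 < (1 + b ^+ 2) * (1 - x) by rewrite mulr_gt0//; lra.
  have : 0 < b * (b * x - w) by rewrite mulr_gt0//; lra.
  by lra.
- rewrite dot_F2 FF -[X in _ < X]mul1r ltr_pM2r// ltr_pdivrMr// mul1r.
  have : 0 < (1 + a ^+ 2) * (1 - x) by rewrite mulr_gt0//; lra.
  have : 0 <= a * (a * x + w) by rewrite mulr_ge0//; lra.
  by lra.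
Qed.

(** The barycentric weights of I are the side lengths, proportional to b + c, c + a, a + b. *)
Lemma det_relation p : (b + c) * det (A - I) (p - I) + (c + a) * det (B - I) (p - I)
  + (a + b) * det (C - I) (p - I) = 0.
Proof.
have [[r0 a0 b0 _] [FF _ _] [A3 _] [_ B3] _] := T.
have F3N0 : dot F3 F3 != 0 by rewrite FF gt_eqF// exprn_gt0.
have n0 := tangential_ab_gt1 T; have rel := half_angle_rel T.
have nN0 : a * b - 1 != 0 by rewrite gt_eqF.
have cE : c = (a + b) / (a * b - 1).
  by apply: (mulIf nN0); rewrite divfK// mulrBr (mulrC c) rel; ring.
have [x [w ->]] := pt_surj I p F3N0.
rewrite (C_pt T) [in A - I]A3 [in B - I]B3 !det_pt cE.
by field.
Qed.

Lemma tri_interior_subset : tri_interior I F3 F1 F2 r `<=` triangle A B C.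
Proof.
have [[r0 a0 b0 c0] [FF _ _] [A3 _] [_ B3] _] := T.
have r2 : 0 < r ^+ 2 by rewrite exprn_gt0.
have F3N0 : dot F3 F3 != 0 by rewrite FF gt_eqF.
have n0 := tangential_ab_gt1 T; have rel := half_angle_rel T.
have nN0 : a * b - 1 != 0 by rewrite gt_eqF.
have cE : c = (a + b) / (a * b - 1).
  by apply: (mulIf nN0); rewrite divfK// mulrBr (mulrC c) rel; ring.
move=> p; have [x [y ->]] := pt_surj I p F3N0.
have q1 : 0 < 1 + b ^+ 2 by rewrite ltr_pwDl// sqr_ge0.
have q2 : 0 < 1 + a ^+ 2 by rewrite ltr_pwDl// sqr_ge0.
have lt1 z : (z * r ^+ 2 < r ^+ 2) = (z < 1) by rewrite -[X in _ < X]mul1r ltr_pM2r.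
rewrite /tri_interior/= dot_foot dot_F1 dot_F2 FF !lt1 => -[h3 h1 h2].
set n1 := ((1 - b ^+ 2) * x + 2 * b * y) / (1 + b ^+ 2) in h1 *.
set n2 := ((1 - a ^+ 2) * x - 2 * a * y) / (1 + a ^+ 2) in h2 *.
have q1N := lt0r_neq0 q1; have q2N := lt0r_neq0 q2.
(* Barycentric coordinates as ratios of areas: in units of r^2, s is twice the area of ABC and (b +
   c) (1 - n1) twice that of the triangle on BC with apex p. *)
pose s := 2 * (a + b + c).
have s0 : 0 < s by rewrite mulr_gt0// !addr_gt0.
have sN := lt0r_neq0 s0.
have E0 : (b + c) * (1 - n1) + (c + a) * (1 - n2) + (a + b) * (1 - x) = s.
  by rewrite /s /n1 /n2 cE; field; rewrite nN0 q2N q1N.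
have E1 : (b + c) * (1 - n1) + (c + a) * (1 - n2)
    + (a + b) * (1 - x) * (- (a * b + 1) / (a * b - 1)) = s * x.
  by rewrite /s /n1 /n2 cE; field; rewrite nN0 q2N q1N.
have E2 : - a * ((b + c) * (1 - n1)) + b * ((c + a) * (1 - n2))
    + (a + b) * (1 - x) * ((a - b) / (a * b - 1)) = s * y.
  by rewrite /s /n1 /n2 cE; field; rewrite nN0 q2N q1N.
have d1 : 0 <= 1 - n1 by rewrite subr_ge0 ltW.
have d2 : 0 <= 1 - n2 by rewrite subr_ge0 ltW.
have d3 : 0 <= 1 - x by rewrite subr_ge0 ltW.
exists ((b + c) * (1 - n1) / s), ((c + a) * (1 - n2) / s), ((a + b) * (1 - x) / s).
split.
- exact: divr_ge0 (mulr_ge0 (ltW (addr_gt0 b0 c0)) d1) (ltW s0).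
- exact: divr_ge0 (mulr_ge0 (ltW (addr_gt0 c0 a0)) d2) (ltW s0).
- exact: divr_ge0 (mulr_ge0 (ltW (addr_gt0 a0 b0)) d3) (ltW s0).
- by rewrite -!mulrDl E0 divff.
have {}E1 : x = s^-1 * ((b + c) * (1 - n1) + (c + a) * (1 - n2)
    + (a + b) * (1 - x) * (- (a * b + 1) / (a * b - 1))).
  by rewrite E1 mulKf.
have {}E2 : y = s^-1 * (- a * ((b + c) * (1 - n1)) + b * ((c + a) * (1 - n2))
    + (a + b) * (1 - x) * ((a - b) / (a * b - 1))).
  by rewrite E2 mulKf.
rewrite [in RHS]A3 B3 (C_pt T) {1}E1 {1}E2 !ptE.
move: E0; set k1 := (b + c) * _; set k2 := (c + a) * _; set k3 := (a + b) * _.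
set c1 := _ / _; set c2 := _ / _ => E0.
have k3E : k3 = s - k1 - k2 by rewrite -E0; ring.
by rewrite k3E; apply: vec_eq; rewrite !vecE/=; field.
Qed.

End fixed_triangle.
End triangle_integral.

(** * The interior and its partition into sectors *)

Section triangle_interior_half.
Context (R : realType).
Local Notation mu := (@lebesgue_measure R).
Local Notation plane := (measurableTypeR R * measurableTypeR R)%type.
Local Notation parea := (mu \x mu : set plane -> \bar R)%E.
Implicit Types (A B C I F G p q u v : R * R) (x y t a b c r : R).

Lemma triangle_rot A B C : triangle A B C = triangle B C A.
Proof.
have sub U V W : triangle U V W `<=` triangle V W U.
  move=> X [x [y [z [? ? ? ? ->]]]]; exists y, z, x; split => //; first lra.
  by apply: vec_eq; rewrite !vecE; ring.
by apply/seteqP; split=> [|X /sub/sub//]; exact: sub.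
Qed.

Lemma continuous_dot I F : continuous (fun p : R * R => dot (p - I) F).
Proof.
move=> p; rewrite /dot; apply: cvgD; apply: cvgM; try exact: cvg_cst.
  by apply: cvgB; [exact: cvg_fst|exact: cvg_cst].
by apply: cvgB; [exact: cvg_snd|exact: cvg_cst].
Qed.

Variables (A B C I F3 F1 F2 : R * R) (a b c r : R).

(** The triangle lies in the closed half-plane, and an interior point can still be moved a little
    along F3. *)
Lemma interior_triangle_lt : tangential A B C I F3 F1 F2 a b c r ->
  interior (triangle A B C) `<=` [set p | dot (p - I) F3 < r ^+ 2].
Proof.
move=> T p; have [[r0 a0 b0 c0] [FF _ _] [A3 _] [_ B3] _] := T.
have r2 : 0 < r ^+ 2 by rewrite exprn_gt0.
have C1 : - (a * b + 1) / (a * b - 1) <= 1.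
  by rewrite ler_pdivrMr ?(tangential_ab_gt1 T)// mul1r; have := mulr_gt0 a0 b0; lra.
have sub X : triangle A B C X -> dot (X - I) F3 <= r ^+ 2.
  move=> [x [y [z [x0 y0 z0 xyz ->]]]].
  have -> : dot (x *: A + y *: B + z *: C - I) F3 =
      x * dot (A - I) F3 + y * dot (B - I) F3 + z * dot (C - I) F3.
    have -> : z = 1 - x - y by lra.
    by rewrite /dot !vecE; ring.
  rewrite A3 B3 (C_pt T) !dot_foot FF.
  have : 0 <= z * (1 - - (a * b + 1) / (a * b - 1)) * r ^+ 2.
    by rewrite !mulr_ge0 ?subr_ge0// ltW.
  have -> : z = 1 - x - y by lra.
  lra.
rewrite /interior/= => np.
have : (fun e : R => p + e *: F3) @ nbhs (0 : R) --> p.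
  rewrite -[X in _ --> X](addr0 p) -[X in _ --> p + X](scale0r F3).
  apply: cvgD; first exact: cvg_cst.
  by apply: cvgZr_tmp; exact: cvg_id.
move=> /(_ _ np); rewrite nbhs_filterE /= => /nbhs_ballP[e /= e0 he].
have /he /sub : ball (0 : R) e (e / 2).
  by rewrite /ball/= sub0r normrN gtr0_norm ?divr_gt0// ltr_pdivrMr// ltr_pMr// ltr1n.
have -> : dot (p + (e / 2) *: F3 - I) F3 = dot (p - I) F3 + e / 2 * dot F3 F3.
  by rewrite /dot !vecE; ring.
by rewrite FF; have := mulr_gt0 e0 r2; lra.
Qed.

End triangle_interior_half.

Section triangle_interior.
Context (R : realType).
Local Notation mu := (@lebesgue_measure R).
Local Notation plane := (measurableTypeR R * measurableTypeR R)%type.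
Local Notation parea := (mu \x mu : set plane -> \bar R)%E.
Lemma measurable_tri_interior (I F3 F1 F2 : R * R) (r : R) :
  measurable (tri_interior I F3 F1 F2 r : set plane).
Proof.
have -> : tri_interior I F3 F1 F2 r =
    [set p | F3.1 * (p.1 - I.1) + F3.2 * (p.2 - I.2) - r ^+ 2 < 0] `&`
    [set p | F1.1 * (p.1 - I.1) + F1.2 * (p.2 - I.2) - r ^+ 2 < 0] `&`
    [set p | F2.1 * (p.1 - I.1) + F2.2 * (p.2 - I.2) - r ^+ 2 < 0].
  rewrite predeqE => p; rewrite /tri_interior /dot /= ?vecE.
  by split=> [[h3 h1 h2]|[[h3 h1] h2]]; do ?split; lra.
by apply: measurableI; first apply: measurableI;
  apply: measurable_lt0; apply: measurable_funB => //; exact: measurable_dot.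
Qed.

Variables (A B C I F3 F1 F2 : R * R) (a b c r : R).

Lemma triangle_interiorE : tangential A B C I F3 F1 F2 a b c r ->
  interior (triangle A B C) = tri_interior I F3 F1 F2 r.
Proof.
move=> T; apply/seteqP; split.
  move=> p pT; split; first exact: (interior_triangle_lt T pT).
    by apply: (interior_triangle_lt (tangential_rot T)); rewrite -triangle_rot.
  by apply: (interior_triangle_lt (tangential_rot (tangential_rot T))); rewrite -2!triangle_rot.
move=> p [h3 h1 h2]; rewrite /interior/=.
have Fp : Filter (nbhs p) by exact: nbhs_filter.
have n3 := cvgr_lt _ (@continuous_dot R I F3 p) _ h3.
have n1 := cvgr_lt _ (@continuous_dot R I F1 p) _ h1.
have n2 := cvgr_lt _ (@continuous_dot R I F2 p) _ h2.
refine (@filterS _ _ Fp _ _ _ (filterI (filterI (n3 Fp) (n1 Fp)) (n2 Fp))) => q [[q3 q1] q2].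
by apply: (tri_interior_subset T); split.
Qed.

(** A sector is a step from a nonnegative to a negative determinant in the cyclic order A, B, C. By
    [det_relation] the three are not all negative, and if all are nonnegative they vanish, forcing p
    = I. *)
Lemma tri_interior_sectors : tangential A B C I F3 F1 F2 a b c r ->
  tri_interior I F3 F1 F2 r `\` [set I] =
  sector A B I F3 r `|` sector B C I F1 r `|` sector C A I F2 r.
Proof.
move=> T; have [[r0 a0 b0 c0] [FF _ _] [A3 _] [_ B3] _] := T.
have r2 : 0 < r ^+ 2 by rewrite exprn_gt0.
have F3N0 : dot F3 F3 != 0 by rewrite FF gt_eqF.
have T1 := tangential_rot T; have T2 := tangential_rot T1.
have notI X Y F : ~ sector X Y I F r I.
  by rewrite /sector/= /det subrr/= !mulr0 subrr ltxx => -[].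
apply/seteqP; split => p; last first.
  move=> h; split; last first.
    by move=> /= pI; move: h; rewrite pI => -[[]|]; exact: notI.
  case: h => [[|]|] h.
  - exact: (sector_sub_interior T h).
  - by rewrite tri_interior_rot; exact: (sector_sub_interior T1 h).
  - by rewrite 2!tri_interior_rot; exact: (sector_sub_interior T2 h).
move=> [[h3 h1 h2] /= pI].
have rel := det_relation T p.
have ab := addr_gt0 a0 b0; have bc := addr_gt0 b0 c0; have ca := addr_gt0 c0 a0.
have [dB|dB] := ltP (det (B - I) (p - I)) 0.
  have [dA|dA] := leP 0 (det (A - I) (p - I)); first by left; left.
  right; split => //.
  rewrite -(pmulr_rge0 _ ab).
  have := nmulr_rlt0 (b + c) dA; rewrite bc mulrC => h.
  have := nmulr_rlt0 (c + a) dB; rewrite ca mulrC => h'.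
  lra.
have [dC|dC] := ltP (det (C - I) (p - I)) 0; first by left; right.
right; split => //.
have dA : (b + c) * det (A - I) (p - I) <= 0.
  have := mulr_ge0 (ltW ca) dB; have := mulr_ge0 (ltW ab) dC; lra.
rewrite pmulr_rle0// in dA; rewrite lt_neqAle dA andbT; apply/negP => /eqP dA0.
have dB0 : det (B - I) (p - I) = 0.
  have h := mulr_ge0 (ltW ca) dB; have h' := mulr_ge0 (ltW ab) dC.
  have /eqP : (c + a) * det (B - I) (p - I) = 0 by rewrite dA0 mulr0 in rel; lra.
  by rewrite mulf_eq0 (gt_eqF ca) => /eqP.
apply: pI; have [x [w pE]] := pt_surj I p F3N0; move: dA0 dB0.
rewrite pE [in A - I]A3 [in B - I]B3 !det_pt => /eqP.
rewrite mulf_eq0 (negbTE F3N0) orbF => /eqP e1 /eqP.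
rewrite mulf_eq0 (negbTE F3N0) orbF => /eqP e2.
have /eqP : (a + b) * x = 0 by lra.
rewrite mulf_eq0 (gt_eqF ab)/= => /eqP x0.
have w0 : w = 0 by rewrite x0 in e1; lra.
by rewrite /pt x0 w0 !scale0r !addr0.
Qed.

Lemma triangle_integral (f : plane -> \bar R) : tangential A B C I F3 F1 F2 a b c r ->
  measurable_fun setT f -> (forall p, 0 <= f p)%E ->
  (forall (x : R) (v : R * R), 0 < x -> f (I + x *: v)%R = f (I + v)%R) ->
  (\int[parea]_(p in tri_interior I F3 F1 F2 r) f p = (r ^+ 2 / 2)%:E *
    (\int[mu]_(t in `[(- a)%R, b[) f (pt I F3 1 (t : R)) +
     \int[mu]_(t in `[(- b)%R, c[) f (pt I F1 1 (t : R)) +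
     \int[mu]_(t in `[(- c)%R, a[) f (pt I F2 1 (t : R))))%E.
Proof.
move=> T mf f0 fh.
have mI : measurable ([set I] : set plane).
  have -> : [set I] = [set I.1] `*` [set I.2].
    rewrite predeqE => -[x y]; split=> [-> //|[/= -> ->]].
    by case: I.
  by apply: measurableX; exact: measurable_set1.
have I0 : parea [set I : plane] = 0%E.
  have -> : [set I] = [set I.1] `*` [set I.2].
    rewrite predeqE => -[x y]; split=> [-> //|[/= -> ->]].
    by case: I.
  rewrite product_measure1E; [|exact: measurable_set1|exact: measurable_set1].
  by rewrite [X in (X * _)%E](lebesgue_measure_set1 I.1) mul0e.
have mU := measurable_tri_interior I F3 F1 F2 r.
have step X Y F x y : 0 < r -> 0 < x -> 0 < y -> dot F F = r ^+ 2 ->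
    X = pt I F 1 (- x) -> Y = pt I F 1 y ->
    (\int[parea]_(p in sector X Y I F r) f p =
     (r ^+ 2 / 2)%:E * \int[mu]_(t in `[(- x)%R, y[) f (pt I F 1 (t : R)))%E.
  move=> r0 x0 y0 FF XE YE.
  have F0 : F != 0.
    apply/eqP => F0; move: FF; rewrite F0 /dot/= mulr0 addr0 => /esym/eqP.
    by rewrite expf_eq0/= gt_eqF.
  rewrite (@cone_integral _ I F x y f (sector X Y I F r) F0 (measurable_sector _ _ _ _ _))//.
    by rewrite FF; congr (_ * _)%E; apply: eq_integral => t _; rewrite /pt scale1r.
  by move=> x' w; exact: sectorP.
have [[r0 a0 b0 c0] [FF3 FF1 FF2] [A3 A2] [B1 B3] [C2 C1]] := T.
rewrite (ge0_negligible_integral mI mU _ _ I0)//; last exact: measurable_funTS.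
rewrite (tri_interior_sectors T).
rewrite ge0_integral_setU//=; last 4 first.
- by apply: measurableU; exact: measurable_sector.
- exact: measurable_sector.
- exact: measurable_funTS.
- apply/disj_setPRL => p [_ hC hA]; apply/not_orP; split.
    by move=> [_ hA' _]; move: hA; rewrite ltNge hA'.
  by move=> [_ _ hC']; move: hC'; rewrite ltNge hC.
rewrite ge0_integral_setU//=; last 4 first.
- exact: measurable_sector.
- exact: measurable_sector.
- exact: measurable_funTS.
- apply/disj_setPRL => p [_ hB _] [_ _ hB'].
  by move: hB'; rewrite ltNge hB.
rewrite (step A B F3 a b)// (step B C F1 b c)// (step C A F2 c a)//.
have i0 D (G : R * R) : (0 <= \int[mu]_(t in D) f (pt I G 1%R (t : R)))%E.
  by apply: integral_ge0 => t _; exact: f0.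
symmetry; rewrite ge0_muleDr; [|exact: adde_ge0 (i0 _ _) (i0 _ _)|exact: i0].
by congr (_ + _)%E; rewrite ge0_muleDr; [|exact: i0|exact: i0].
Qed.

End triangle_interior.

(** * Pairs of points at a non-acute angle *)

Section obtuse_pairs.
Context (R : realType).
Local Notation mu := (@lebesgue_measure R).
Local Notation mR := (measurableTypeR R).
Local Notation plane := (mR * mR)%type.
Local Notation parea := (mu \x mu : set plane -> \bar R)%E.

Definition obtuse (I : R * R) : set (plane * plane) :=
  [set z | dot (z.1 - I : R * R) (z.2 - I : R * R) <= 0].

Lemma measurable_obtuse (I : R * R) : measurable (obtuse I).
Proof.
pose g (z : plane * plane) : mR :=
  (z.1.1 - I.1 : R) * (z.2.1 - I.1 : R) + (z.1.2 - I.2 : R) * (z.2.2 - I.2 : R).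
have m11 : measurable_fun [set: plane * plane] (fun z : plane * plane => z.1.1).
  exact: (measurableT_comp measurable_fst measurable_fst).
have m12 : measurable_fun [set: plane * plane] (fun z : plane * plane => z.1.2).
  exact: (measurableT_comp measurable_snd measurable_fst).
have m21 : measurable_fun [set: plane * plane] (fun z : plane * plane => z.2.1).
  exact: (measurableT_comp measurable_fst measurable_snd).
have m22 : measurable_fun [set: plane * plane] (fun z : plane * plane => z.2.2).
  exact: (measurableT_comp measurable_snd measurable_snd).
have mg : measurable_fun setT g.
  by apply: measurable_funD; apply: measurable_funM; apply: measurable_funB.
rewrite (_ : obtuse I = g @^-1` `]-oo, 0]%classic).
  by rewrite -[X in measurable X]setTI; apply: mg => //; exact: measurable_itv.
by rewrite predeqE => z; rewrite /obtuse /g /dot /preimage/mkset !in_itv /= ?vecE.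
Qed.

(* Length, in units of the inradius, of the part of a side seen from I at a
   non-acute angle with p. *)
Definition side_weight (I F : R * R) (l h : R) (p : R * R) : \bar R :=
  mu [set u : R | l <= u < h /\ dot (p - I) (pt I F 1 u - I) <= 0].

Lemma side_weight_ge0 I F l h p : (0 <= side_weight I F l h p)%E.
Proof. exact: measure_ge0. Qed.

Variables (A B C I F3 F1 F2 : R * R) (a b c r : R).
Hypothesis T : tangential A B C I F3 F1 F2 a b c r.

Let D := tri_interior I F3 F1 F2 r : set plane.

Lemma side_weightE (F : R * R) (l h : R) (p : plane) :
  (\int[mu]_(u in `[l, h[) (\1_(xsection (obtuse I) p) (pt I F 1%R (u : R)))%:E =
   side_weight I F l h p)%E.
Proof.
pose E : set mR := [set u : R | dot (p - I) F + u * dot (p - I) (rot F) <= 0].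
have EE (u : R) : E u <-> dot (p - I) (pt I F 1 u - I) <= 0.
  rewrite /E/=; suff -> : dot (p - I) (pt I F 1 u - I) = dot (p - I) F + u * dot (p - I) (rot F) by [].
  by rewrite ptE /dot /rot /= ?vecE; ring.
have mE : measurable E.
  rewrite (_ : E = (fun u : mR => dot (p - I) F + (u : R) * dot (p - I) (rot F) : mR) @^-1` `]-oo, 0]%classic).
    rewrite -[X in measurable X]setTI.
    have mf : measurable_fun [set: mR] (fun u : mR => dot (p - I) F + (u : R) * dot (p - I) (rot F) : mR).
      by apply: measurable_funD => //; apply: measurable_funM.
    by apply: mf => //; exact: measurable_itv.
  by rewrite predeqE => u; rewrite /E /preimage/mkset in_itv.
transitivity (\int[mu]_(u in `[l, h[) (\1_E u)%:E)%E.
  apply: eq_integral => u _; rewrite !indicE; congr ((nat_of_bool _)%:R%:E).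
  apply/idP/idP; rewrite !inE /xsection/= inE /obtuse/=.
    by move=> ?; apply/EE.
  by move=> /EE.
rewrite integral_indic//; congr (mu _).
rewrite predeqE => u; split=> [[/EE h1 h2]|[h1 /EE h2]]; split => //.
Qed.

(** For fixed p, the indicator of a non-acute angle depends only on the direction of the second
    point from I. *)
Lemma obtuse_section_area (p : plane) :
  parea (xsection (obtuse I) p `&` D) = ((r ^+ 2 / 2)%:E *
    (side_weight I F3 (- a) b p + side_weight I F1 (- b) c p + side_weight I F2 (- c) a p))%E.
Proof.
have mS : measurable (xsection (obtuse I) p) by apply: measurable_xsection; exact: measurable_obtuse.
have mD : measurable D by exact: measurable_tri_interior.
rewrite -integral_indic//.
have dotI (v : R * R) : dot (p - I) (I + v - I) = dot (p - I) v.
  by rewrite /dot !vecE; ring.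
have dotZ (v : R * R) x : dot (p - I) (x *: v) = x * dot (p - I) v.
  by rewrite /dot !vecE; ring.
rewrite (triangle_integral T)//; last 2 first.
- by apply/measurable_EFinP; exact: measurable_indic.
- move=> x v x0; rewrite !indicE; congr ((nat_of_bool _)%:R%:E).
  apply/idP/idP; rewrite !inE /xsection/= !inE /obtuse/= !dotI dotZ pmulr_rle0//.
by rewrite !side_weightE.
Qed.

(* For P on the side AB, Q runs over the same side, then over the sides adjacent
   at B and at A. *)
Lemma side_row : has_integral
  (fun t => side_weight I F3 (- a) b (pt I F3 1 t) + side_weight I F1 (- b) c (pt I F3 1 t)
     + side_weight I F2 (- c) a (pt I F3 1 t))%E (- a) b
  (2 * (a * b - 1 - ln (a * b))
   + (a * b + b * c + c * a - 1 - 2 * Gam ((b ^+ 2 - 1) / (b ^+ 2 + 1)) + 2 * ln b)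
   + (a * b + b * c + c * a - 1 - 2 * Gam ((a ^+ 2 - 1) / (a ^+ 2 + 1)) + 2 * ln a)).
Proof.
have [[r0 a0 b0 c0] [FF3 FF1 FF2] [A3 A2] [B1 B3] [C2 C1]] := T.
have r2 : 0 < r ^+ 2 by rewrite exprn_gt0.
have rel := half_angle_rel T.
have q (x : R) : 0 < 1 + x ^+ 2 by rewrite ltr_pwDl// sqr_ge0.
apply: has_integral_add; [by move=> x; apply: adde_ge0|by []|apply: has_integral_add => //|].
- have ab1 : 1 <= a * b by have := tangential_ab_gt1 T; lra.
  have := same_side_has_integral a0 b0 ab1.
  congr has_integral; apply/funext => t; congr (mu _); rewrite predeqE => u /=.
  by rewrite dot_pt FF3 mulr1 pmulr_lle0.
- have := corner_has_integral_fst a0 b0 c0 rel.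
  congr has_integral; apply/funext => t; congr (mu _); rewrite predeqE => u /=.
  have BB : pt I F1 1 (- b) = pt I F3 1 b by rewrite -B1.
  by rewrite (dot_adjacent _ _ BB) FF3 -mulrA pmulr_lle0// divr_gt0.
- have rel' : b * a * c = b + a + c by lra.
  have := corner_has_integral_snd b0 a0 c0 rel'.
  have -> : b * a + a * c + c * b = a * b + b * c + c * a by ring.
  congr has_integral; apply/funext => t; congr (mu _); rewrite predeqE => u /=.
  have AA : pt I F3 1 (- a) = pt I F2 1 a by rewrite -A3.
  rewrite dotC (dot_adjacent _ _ AA) FF2 -mulrA pmulr_lle0 ?divr_gt0//.
  by rewrite (_ : corner a u (- t) = corner a (- t) u)// /corner; ring.
Qed.

End obtuse_pairs.

Lemma has_integral_scale (R : realType) (h : R -> \bar R) (l r k v : R) : 0 <= k ->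
  (forall x, 0 <= h x)%E -> has_integral h l r v ->
  has_integral (fun x => k%:E * h x)%E l r (k * v).
Proof.
move=> k0 h0 [lr mh vE]; split => //; first exact: measurable_funeM.
by rewrite ge0_integralZl// vE.
Qed.

Section obtuse_measure.
Context (R : realType).
Local Notation mu := (@lebesgue_measure R).
Local Notation mR := (measurableTypeR R).
Local Notation plane := (mR * mR)%type.
Local Notation parea := (mu \x mu : set plane -> \bar R)%E.
Variables (A B C I F3 F1 F2 : R * R) (a b c r : R).
Hypothesis T : tangential A B C I F3 F1 F2 a b c r.

Lemma area_tri_interior :
  parea (tri_interior I F3 F1 F2 r) = (r ^+ 2 * (a + b + c))%:E.
Proof.
have [[r0 a0 b0 c0] _ _ _ _] := T.
have mD : measurable (tri_interior I F3 F1 F2 r : set plane) by exact: measurable_tri_interior.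
rewrite -[LHS]mul1e -integral_cst//.
rewrite (triangle_integral T)//.
have len (F : R * R) (x y : R) : 0 < x -> 0 < y ->
    (\int[mu]_(t in `[(- x)%R, y[) (cst 1 : plane -> \bar R) (pt I F 1%R (t : R)) = (x + y)%:E)%E.
  move=> x0 y0; transitivity (\int[mu]_(t in `[(- x)%R, y[) (cst 1 : R -> \bar R) t)%E.
    by apply: eq_integral.
  rewrite integral_cst// [X in (_ * X)%E](@lebesgue_measure_bnd R (- x) y true true); last by lra.
  by rewrite mul1e opprK addrC.
rewrite (len F3 a b)// (len F1 b c)// (len F2 c a)// -!EFinD -EFinM; congr (_%:E).
by field.
Qed.

(** The section area is itself homogeneous of degree 0 in p, so [triangle_integral] applies again
    and the nine pairs appear as three rows. *)
Lemma obtuse_pairs_measure :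
  (\int[parea]_(p in tri_interior I F3 F1 F2 r)
     parea (xsection (obtuse I) p `&` tri_interior I F3 F1 F2 r) =
   (r ^+ 4 * (2 * (a * b + b * c + c * a) - 3 - Gam ((a ^+ 2 - 1) / (a ^+ 2 + 1))
      - Gam ((b ^+ 2 - 1) / (b ^+ 2 + 1)) - Gam ((c ^+ 2 - 1) / (c ^+ 2 + 1))))%:E)%E.
Proof.
have [[r0 a0 b0 c0] _ _ _ _] := T.
have T1 := tangential_rot T; have T2 := tangential_rot T1.
have mD : measurable (tri_interior I F3 F1 F2 r : set plane) by exact: measurable_tri_interior.
have mDT : measurable (obtuse I `&` (setT `*` (tri_interior I F3 F1 F2 r : set plane))).
  by apply: measurableI; [exact: measurable_obtuse|exact: measurableX].
pose f (p : plane) := parea (xsection (obtuse I) p `&` tri_interior I F3 F1 F2 r).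
have fE : f = parea \o xsection (obtuse I `&` (setT `*` (tri_interior I F3 F1 F2 r : set plane))).
  apply/funext => p; rewrite /f /=; congr product_measure1.
  by rewrite predeqE => q; rewrite /xsection/= !inE/=; split=> [[? ?]|[? [_ ?]]].
have mf : measurable_fun setT f by rewrite fE; exact: (@measurable_fun_xsection _ _ _ _ _ (@plane_area R) _ mDT).
have dotI (v q : R * R) : dot (I + v - I) q = dot v q.
  by rewrite /dot !vecE; ring.
have dotZ (v q : R * R) x : dot (x *: v) q = x * dot v q.
  by rewrite /dot !vecE; ring.
rewrite -/(f _) (triangle_integral T mf); last 2 first.
- by move=> p; exact: measure_ge0.
- move=> x v x0; rewrite /f; congr product_measure1; congr (_ `&` _).
  rewrite predeqE => q; rewrite /xsection/= !inE /obtuse/= !dotI dotZ.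
  by rewrite pmulr_rle0.
have r4 : 0 <= r ^+ 2 / 2 by rewrite divr_ge0 ?sqr_ge0.
have row X Y Z G3 G1 G2 x y z : tangential X Y Z I G3 G1 G2 x y z r ->
    (forall p, f p = (r ^+ 2 / 2)%:E * (side_weight I G3 (- x) y p
       + side_weight I G1 (- y) z p + side_weight I G2 (- z) x p))%E ->
    (\int[mu]_(t in `[(- x)%R, y[) f (pt I G3 1 (t : R)) = (r ^+ 2 / 2 *
     (2 * (x * y - 1 - ln (x * y))
   + (x * y + y * z + z * x - 1 - 2 * Gam ((y ^+ 2 - 1) / (y ^+ 2 + 1)) + 2 * ln y)
   + (x * y + y * z + z * x - 1 - 2 * Gam ((x ^+ 2 - 1) / (x ^+ 2 + 1)) + 2 * ln x)))%:E)%E.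
  move=> TX fw; have := has_integral_scale r4 _ (side_row TX).
  move=> H; rewrite -(has_integral_bnd true true (H _)); last first.
    by move=> t; rewrite !adde_ge0.
  by apply: eq_integral => t _; rewrite fw.
rewrite (row _ _ _ _ _ _ _ _ _ T); last by move=> p; exact: (obtuse_section_area T).
rewrite (row _ _ _ _ _ _ _ _ _ T1); last first.
  by move=> p; rewrite /f (obtuse_section_area T) -addeA addeC.
rewrite (row _ _ _ _ _ _ _ _ _ T2); last first.
  by move=> p; rewrite /f (obtuse_section_area T) addeC addeA.
rewrite -!EFinD -EFinM; congr (_%:E).
have lnE x y : 0 < x -> 0 < y -> ln (x * y) = ln x + ln y :> R.
  by move=> x0 y0; rewrite lnM ?posrE.
(* Each row has no net logarithm. The rows add up to 8 (ab + bc + ca) - 12 minus four times the sum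
   of the Gammas, and the prefactor is r^4 / 4. *)
by rewrite (lnE a b)// (lnE b c)// (lnE c a)//; field.
Qed.

End obtuse_measure.

(** * From independent uniform points to a double integral *)

Section uniform_pair.
Context (R : realType).
Local Notation mu := (@lebesgue_measure R).
Local Notation mR := (measurableTypeR R).
Local Notation plane := (mR * mR)%type.
Local Notation parea := (mu \x mu : set plane -> \bar R)%E.
Context (d : measure_display) (T : measurableType d) (Pr : probability T R).
Variables (P Q : {RV Pr >-> (R * R)%type}) (D : set (R * R)) (alpha : R).
Hypothesis mD : measurable (D : set plane).
Hypothesis alpha0 : 0 < alpha.
Hypothesis areaD : parea D = alpha%:E.
Hypothesis P_uniform : uniform_on P D.
Hypothesis Q_uniform : uniform_on Q D.
Hypothesis PQ_independent : independent_RV P Q.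

(* [R * R] and [plane] have the same measurable sets but different displays;
   integrals against [area] only exist on the latter. *)
Let mP : measurable_fun [set: T] (P : T -> plane). Proof. exact: (measurable_funPT P). Qed.
Let mQ : measurable_fun [set: T] (Q : T -> plane). Proof. exact: (measurable_funPT Q). Qed.
Let P' : {RV Pr >-> plane} := HB.pack (P : T -> plane) (isMeasurableFun.Build _ _ _ _ _ mP).
Let Q' : {RV Pr >-> plane} := HB.pack (Q : T -> plane) (isMeasurableFun.Build _ _ _ _ _ mQ).
Let mPQ : measurable_fun [set: T] (fun w => (P w, Q w) : plane * plane).
Proof. by apply: measurable_fun_pair. Qed.
Let PQ : {RV Pr >-> (plane * plane)%type} :=
  HB.pack (fun w => (P w, Q w) : plane * plane) (isMeasurableFun.Build _ _ _ _ _ mPQ).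

Let uniformE (X : {RV Pr >-> (R * R)%type}) : uniform_on X D ->
  forall E : set plane, measurable E -> Pr (X @^-1` E) = ((alpha^-1)%:E * parea (E `&` D))%E.
Proof.
move=> uX E mE; have := uX E mE; rewrite /distribution /pushforward => ->.
change (parea (E `&` D) / parea D = (alpha^-1)%:E * parea (E `&` D))%E.
by rewrite areaD inver gt_eqF// muleC.
Qed.

(** Independence concerns rectangles only. The joint law and the normalized area on D x D agree
    there with the product of the marginals, so both equal it by uniqueness of the product
    measure. *)
Lemma uniform_pair_probability (S : set (plane * plane)) : measurable S ->
  Pr [set w | S (P w, Q w)] =
  ((alpha ^- 2)%:E * \int[parea]_(p in D) parea (xsection S p `&` D))%E.
Proof.
move=> mS.
have k0 : 0 <= alpha ^- 2 by rewrite invr_ge0 sqr_ge0.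
pose k : {nonneg R} := NngNum k0.
have mDD : measurable (D `*` D : set (plane * plane)) by exact: measurableX.
pose m1 : probability plane R := distribution Pr P'.
pose m2 : probability plane R := distribution Pr Q'.
pose m12 : probability (plane * plane)%type R := distribution Pr PQ.
have ind (E F : set plane) : measurable E -> measurable F ->
    m12 (E `*` F) = (m1 E * m2 F)%E.
  by move=> mE mF; have h := PQ_independent mE mF; exact h.
have PE : (m1 \x m2)%E S = Pr [set w | S (P w, Q w)].
  have H := @product_measure_unique _ _ plane plane R m1 m2 m12 ind S mS.
  exact H.
pose m : {sigma_finite_measure set plane -> \bar R} := @plane_area R.
pose mm : {measure set (plane * plane) -> \bar R} := (m \x m)%E.
pose m3 : {measure set (plane * plane) -> \bar R} := mscale k (mrestr mm mDD).
have uni (E F : set plane) : measurable E -> measurable F ->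
    m3 (E `*` F) = (m1 E * m2 F)%E.
  move=> mE mF; have e1 := uniformE P_uniform mE; have e2 := uniformE Q_uniform mF.
  have -> : m1 E = ((alpha^-1)%:E * m (E `&` D))%E by exact e1.
  have -> : m2 F = ((alpha^-1)%:E * m (F `&` D))%E by exact e2.
  have -> : m3 (E `*` F) = ((alpha ^- 2)%:E * (m \x m)%E ((E `*` F) `&` (D `*` D)))%E by [].
  rewrite -setXI product_measure1E; [|exact: measurableI|exact: measurableI].
  by rewrite [RHS]muleACA -EFinM -invfM -expr2.
rewrite -PE (@product_measure_unique _ _ plane plane R m1 m2 m3 uni S mS).
have E2 : (m \x m)%E (S `&` (D `*` D)) = (\int[m]_(p in D) m (xsection S p `&` D))%E.
  rewrite [RHS]integral_mkcond; apply: eq_integral => p _.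
  rewrite patchE /=; case: ifPn => pD.
    rewrite inE in pD; congr (m _); rewrite predeqE => q; rewrite /xsection/= !inE/=.
    by split=> [[? []]|[]].
  rewrite -[RHS](measure0 m); congr (m _).
  rewrite predeqE => q; rewrite /xsection/= !inE/=; split=> // -[_ [pD' _]].
  by move/negP: pD; apply; rewrite inE.
change ((alpha ^- 2)%:E * (m \x m)%E (S `&` (D `*` D)) =
  (alpha ^- 2)%:E * \int[m]_(p in D) m (xsection S p `&` D))%E.
by rewrite E2.
Qed.

End uniform_pair.

(** Thales: with M the midpoint, |I - M|^2 = |V - U|^2 / 4 + <U - I, V - I>. *)
Lemma diametral_diskE (R : realType) (U V I : R * R) :
  diametral_disk U V I <-> dot (U - I) (V - I) <= 0.
Proof.
have nn (u : R * R) : 0 <= dot u u by rewrite /dot -!expr2 addr_ge0 ?sqr_ge0.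
rewrite /diametral_disk /closed_disk/= /Defs.edist.
set M := 2^-1 *: (U + V).
have -> : (Num.sqrt (dot (I - M) (I - M)) <= Num.sqrt (dot (V - U) (V - U)) / 2) =
    (dot (I - M) (I - M) <= dot (V - U) (V - U) / 4).
  rewrite -(@ler_pXn2r _ 2)//; try by rewrite nnegrE ?divr_ge0 ?sqrtr_ge0.
  rewrite exprMn !sqr_sqrtr// exprVn; congr (_ <= _ / _); ring.
have E : dot (I - M) (I - M) = dot (V - U) (V - U) / 4 + dot (U - I) (V - I).
  by rewrite /M /dot !vecE; field.
by rewrite E gerDl.
Qed.

Lemma tangential_probability (R : realType) (A B C I F3 F1 F2 : R * R) (a b c r Rc : R)
    (d : measure_display) (T : measurableType d) (Pr : probability T R)
    (P Q : {RV Pr >-> (R * R)%type}) :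
  tangential A B C I F3 F1 F2 a b c r -> is_circumradius A B C Rc ->
  uniform_on P (interior (triangle A B C)) ->
  uniform_on Q (interior (triangle A B C)) -> independent_RV P Q ->
  Pr [set w | diametral_disk (P w) (Q w) I] =
    ((r / semiperimeter A B C) ^+ 2 *
     (8 * Rc / r - 1 - Gam (cos (angle B A C)) - Gam (cos (angle C B A))
        - Gam (cos (angle A C B))))%:E.
Proof.
move=> TT hRc; rewrite (triangle_interiorE TT) => uP uQ PQ.
have [[r0 a0 b0 c0] _ _ _ _] := TT.
have T1 := tangential_rot TT; have T2 := tangential_rot T1.
have s0 : 0 < a + b + c by rewrite !addr_gt0.
have alpha0 : 0 < r ^+ 2 * (a + b + c) by rewrite mulr_gt0// exprn_gt0.
rewrite (_ : [set w | _] = [set w | obtuse I (P w, Q w)]); last first.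
  by rewrite predeqE => w; exact: diametral_diskE.
rewrite (uniform_pair_probability (measurable_tri_interior I F3 F1 F2 r) alpha0
  (area_tri_interior TT) uP uQ PQ (measurable_obtuse I)).
rewrite (obtuse_pairs_measure TT) -EFinM (tangential_semiperimeter TT).
rewrite (tangential_circumradius TT hRc) (cos_angle_A TT) (cos_angle_A T1).
rewrite (cos_angle_A T2); congr (_%:E).
have rN := lt0r_neq0 r0; have sN := lt0r_neq0 s0.
set Ga := Gam _; set Gb := Gam _; set Gc := Gam _.
by field; rewrite rN sN.
Qed.

Theorem theorem3p1 (R : realType) (A B C I : R * R) (r Rc : R)
    (ABC_nondegenerate : ~ collinear A B C)
    (incircle : is_incircle A B C I r)
    (circumradius : is_circumradius A B C Rc)
    (d : measure_display) (T : measurableType d) (Pr : probability T R)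
    (P Q : {RV Pr >-> (R * R)%type})
    (P_uniform : uniform_on P (interior (triangle A B C)))
    (Q_uniform : uniform_on Q (interior (triangle A B C)))
    (PQ_independent : independent_RV P Q) :
  Pr [set w | diametral_disk (P w) (Q w) I] =
    ((r / semiperimeter A B C) ^+ 2 *
     (8 * Rc / r - 1 - Gam (cos (angle B A C)) - Gam (cos (angle C B A))
        - Gam (cos (angle A C B))))%:E.
Proof.
have [F3 [F1 [F2 [a [b [c [T1|T1]]]]]]] := tangential_exists ABC_nondegenerate incircle.
  exact: (tangential_probability T1).
(* Negative orientation: the result for A, C, B is carried back, since every quantity involved is
   symmetric under exchanging B and C. *)
have triE : triangle A B C = triangle A C B.
  have sub (U V W : R * R) : triangle U V W `<=` triangle U W V.
    move=> X [x [y [z [? ? ? ? ->]]]]; exists x, z, y; split => //; first lra.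
    by apply: vec_eq; rewrite !vecE; ring.
  by apply/seteqP; split; exact: sub.
have circ : is_circumradius A C B Rc.
  by case: circumradius => Z [ZA ZB ZC]; exists Z.
rewrite triE in P_uniform Q_uniform.
rewrite (tangential_probability T1 circ P_uniform Q_uniform PQ_independent).
have -> : semiperimeter A C B = semiperimeter A B C.
  rewrite /semiperimeter (edist_sym C B) (edist_sym B A) (edist_sym A C).
  by congr (_ / _); ring.
rewrite (angle_sym C A B) (angle_sym B C A) (angle_sym A B C).
by congr (_%:E); ring.
Qed.
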